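(* The operator ideal $\mathscr{WCG}$ is not symmetric: there is a weakly compactly generated operator whose adjoint is not weakly compactly generated. Conversely, there is an operator $T$ which is not weakly compactly generated although its adjoint $T^*$ is weakly compactly generated.
   Context: Operators are bounded linear maps between Banach spaces. A Banach space is weakly compactly generated (WCG) if it contains a weakly compact subset whose linear span is dense. An operator $T\colon E\to F$ is weakly compactly generated if there is a closed subspace $Z$ of $F$ that is a WCG Banach space and satisfies $T(E)\subseteq Z$; $\mathscr{WCG}$ is the class of all such operators. *)

(* Defs.v *)
From HB Require Import structures.
From mathcomp Require Import all_boot all_order all_algebra.
From mathcomp Require Import complex.
From mathcomp Require Import all_classical all_reals all_analysis.

Set Implicit Arguments.
Unset Strict Implicit.
Unset Printing Implicit Defensive.

Import Order.TTheory GRing.Theory Num.Theory.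
Import numFieldNormedType.Exports.

Local Open Scope classical_set_scope.
Local Open Scope ring_scope.

Inductive real_or_complex (R : realType) : numFieldType -> Prop :=
| real_scalars : real_or_complex R (R : numFieldType)
| complex_scalars : real_or_complex R (R[i] : numFieldType).

(* [normedModType K] has a [K]-valued norm, so an operator norm is a supremum
   in [K]; the two lemmas of this section provide what is needed of [K]. *)
Section Scalars.

Lemma real_or_complex_supremums (R : realType) (K : numFieldType) (A : set K) :
  real_or_complex R K -> A !=set0 -> (forall a, A a -> 0 <= a) ->
  ubound A !=set0 -> supremums A !=set0.
Proof.
move=> hK; case: K / hK A => A A0 Age0 [M AM].
  have hA : has_sup A by split => //; exists M.
  exists (sup A); split; first exact: sup_upper_bound.
  by move=> y Ay; apply: ge_sup.
pose B : set R := [set complex.Re a | a in A].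
have hB : has_sup B.
  split; first by case: A0 => a Aa; exists (complex.Re a); exists a.
  by exists (complex.Re M) => _ [a Aa <-]; have := AM _ Aa; rewrite lecE => /andP[].
have Are a : A a -> a = ((complex.Re a)%:C)%C.
  by move=> /Age0; case: a => a b; rewrite lecE /= => /andP[/eqP-> _].
exists ((sup B)%:C)%C; split.
  move=> a Aa; rewrite (Are _ Aa) lecE /= eqxx /=.
  by apply: sup_upper_bound => //; exists a.
move=> y Ay; rewrite lecE /=.
have [a Aa] := A0.
have := Ay _ Aa; rewrite {1}(Are _ Aa) lecE /= => /andP[-> _] /=.
apply: ge_sup; first by case: hB.
by move=> _ [b Ab <-]; have := Ay _ Ab; rewrite lecE => /andP[].
Qed.

Lemma real_or_complex_complete (R : realType) (K : numFieldType)
    (F : set_system K^o) :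
  real_or_complex R K -> ProperFilter F -> cauchy F -> cvg F.
Proof.
move=> hK; case: K / hK F => F FF Fc; first exact: (@R_complete R).
have Fb (e : R) : 0 < e -> exists z : R[i],
    F [set w | `|complex.Re (z - w)| < e /\ `|complex.Im (z - w)| < e].
  move=> e0.
  have eC : 0 < (e%:C)%C :> R[i] by rewrite ltcE /= eqxx.
  have [z Fz] := (cauchyP F).1 Fc _ eC.
  exists z; apply: filterS Fz => w; rewrite -ball_normE /= => zw.
  have := le_lt_trans (normc_ge_Re (z - w)) zw.
  rewrite ltcE /= eqxx /= => h1; split => //.
  have := le_lt_trans (normc_ge_Re ((z - w) * 'i%C)) _ => /(_ (e%:C)%C).
  have ni : `|'i%C : R[i]| = 1 by rewrite normc_def /= expr0n /= expr1n add0r sqrtr1.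
  rewrite normrM ni mulr1 => /(_ zw).
  rewrite ltcE /= eqxx /= => h2.
  move: h2; case: (z - w) => a b /=.
  by rewrite mulr0 mulr1 sub0r normrN.
have cRe : cvg (@complex.Re R @ F : set_system R).
  apply: R_complete; apply: (@cauchy_exP R R^o) => e e0; have [z Fz] := Fb _ e0.
  exists (complex.Re z).
  apply: (@filterS _ F FF _ (@complex.Re R @^-1` ball (complex.Re z) e) _ Fz).
  move=> w /= [+ _].
  by rewrite -ball_normE; case: (z) (w) => ? ? [? ?].
have cIm : cvg (@complex.Im R @ F : set_system R).
  apply: R_complete; apply: (@cauchy_exP R R^o) => e e0; have [z Fz] := Fb _ e0.
  exists (complex.Im z).
  apply: (@filterS _ F FF _ (@complex.Im R @^-1` ball (complex.Im z) e) _ Fz).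
  move=> w /= [_ +].
  by rewrite -ball_normE; case: (z) (w) => ? ? [? ?].
pose a : R := lim (@complex.Re R @ F : set_system R).
pose b : R := lim (@complex.Im R @ F : set_system R).
apply/cvg_ex; exists (a +i* b)%C.
apply/cvgrPdist_lt => e e0.
have er : e = ((complex.Re e)%:C)%C.
  by move: e0; case: e => x y; rewrite ltcE /= => /andP[/eqP-> _].
have re0 : 0 < complex.Re e / 2 by move: e0; rewrite er ltcE /= => /andP[_ h]; rewrite divr_gt0.
have /cvgrPdist_lt/(_ _ re0) FRe := cRe.
have /cvgrPdist_lt/(_ _ re0) FIm := cIm.
near=> w.
have h1 : `|a - complex.Re w| < complex.Re e / 2 by near: w; exact: FRe.
have h2 : `|b - complex.Im w| < complex.Re e / 2 by near: w; exact: FIm.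
have -> : (a +i* b)%C - w = ((a - complex.Re w)%:C)%C + ((b - complex.Im w)%:C)%C * 'i%C.
  by case: (w) => u v /=; apply/eqP; rewrite eq_complex /= !mul0r !mulr0 !mulr1 subr0 !addr0 add0r !eqxx.
apply: le_lt_trans (ler_normD _ _) _.
have ni : `|'i%C : R[i]| = 1 by rewrite normc_def /= expr0n /= expr1n add0r sqrtr1.
have nr (x : R) : `|(x%:C)%C : R[i]| = (`|x|%:C)%C.
  by rewrite normc_def /= expr0n /= addr0 sqrtr_sqr.
rewrite normrM ni mulr1 !nr er -rmorphD ltcR.
by rewrite (splitr (complex.Re e)) ltrD.
Unshelve. all: by end_near. Qed.

End Scalars.

Section Operators.
Variables (K : numFieldType) (E F : normedModType K).

Definition bounded_linear (f : E -> F) : Prop :=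
  linear f /\ exists M : K, forall x, `|f x| <= M * `|x|.

Definition is_operator : {pred E -> F} := mem [set f | bounded_linear f].

Record operator := Operator {
  operator_fun :> E -> F;
  operatorP : operator_fun \in is_operator }.

HB.instance Definition _ := [isSub for operator_fun].
HB.instance Definition _ := [Choice of operator by <:].

Lemma operator_bounded_linear (T : operator) : bounded_linear T.
Proof. exact: set_mem (operatorP T). Qed.

Lemma operator_is_linear (T : operator) : linear T.
Proof. by case: (operator_bounded_linear T). Qed.

HB.instance Definition _ (T : operator) :=
  GRing.isLinear.Build K E F *:%R T (operator_is_linear T).

Lemma operator_bound (T : operator) :
  exists2 M : K, 0 <= M & forall x, `|T x| <= M * `|x|.
Proof.
have [_ [M TM]] := operator_bounded_linear T.
exists `|M| => // x; rewrite -[`|x|]normr_id -normrM.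
by apply: le_trans (TM x) _; rewrite real_ler_norm // ger0_real //;
  exact: le_trans (TM x).
Qed.

Lemma is_operator_submod_closed : submod_closed is_operator.
Proof.
split.
  apply: mem_set; split; first by move=> a x y; rewrite scaler0 addr0.
  by exists 0 => x; rewrite normr0 mul0r.
move=> a f g Hf Hg; apply: mem_set; split.
  have lf : linear f := operator_is_linear (Operator Hf).
  have lg : linear g := operator_is_linear (Operator Hg).
  move=> b x y; rewrite -[LHS]/(a *: f (b *: x + y) + g (b *: x + y)) lf lg.
  rewrite -[RHS]/(b *: (a *: f x + g x) + (a *: f y + g y)).
  by rewrite !scalerDr !scalerA [a * b]mulrC addrACA.
have [M M0 fM] := operator_bound (Operator Hf).
have [N N0 gN] := operator_bound (Operator Hg).
exists (`|a| * M + N) => x; rewrite -[(_ + _) x]/(a *: f x + g x) mulrDl.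
apply: le_trans (ler_normD _ _) _; apply: lerD; last exact: gN.
by rewrite normrZ -mulrA ler_wpM2l //; exact: fM.
Qed.

HB.instance Definition _ :=
  GRing.isSubmodClosed.Build K (E -> F) is_operator is_operator_submod_closed.
HB.instance Definition _ := [SubChoice_isSubLmodule of operator by <:].

End Operators.

(* The scalar field is [K^o] when it is regarded as a Banach space. *)
Definition dual (R : realType) (K : numFieldType) (hK : real_or_complex R K)
  (E : normedModType K) : Type := operator E K^o.

Section DualNorm.
Variables (R : realType) (K : numFieldType) (hK : real_or_complex R K).
Variable E : normedModType K.

HB.instance Definition _ := GRing.Lmodule.on (dual hK E).

Definition dual_norm (phi : dual hK E) : K :=
  supremum 0 [set `|phi x| | x in [set x : E | `|x| <= 1]].

Lemma dual_norm_sup (phi : dual hK E) :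
  supremums [set `|phi x| | x in [set x : E | `|x| <= 1]] (dual_norm phi).
Proof.
rewrite /dual_norm /supremum; set A := (X in X == set0).
have A0 : A !=set0 by exists `|phi 0|; exists 0 => //=; rewrite normr0 ler01.
case: ifPn => [/eqP A0'|_]; first by case: A0 => a; rewrite A0'.
have [M M0 phiM] := operator_bound phi.
have [m Am] : supremums A !=set0.
  apply: (real_or_complex_supremums hK A0); first by move=> _ [x _ <-].
  exists M => _ [x /= x1 <-]; apply: le_trans (phiM x) _.
  by rewrite -[leRHS]mulr1 ler_wpM2l.
by case: xgetP => // /(_ m).
Qed.

Lemma dual_norm_ge0 (phi : dual hK E) : 0 <= dual_norm phi.
Proof.
apply: le_trans (normr_ge0 (phi 0)) _; apply: (dual_norm_sup phi).1.
by exists 0 => //=; rewrite normr0 ler01.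
Qed.

Lemma dual_norm_le (phi : dual hK E) x : `|phi x| <= dual_norm phi * `|x|.
Proof.
have [->|x0] := eqVneq x 0; first by rewrite linear0 !normr0 mulr0.
have nx0 : 0 < `|x| by rewrite normr_gt0.
have: `|phi (`|x|^-1 *: x)| <= dual_norm phi.
  by apply: (dual_norm_sup phi).1; exists (`|x|^-1 *: x) => //=; rewrite normfZV.
by rewrite linearZ normrZ normfV normr_id mulrC ler_pdivrMr.
Qed.

Lemma dual_norm_least (phi : dual hK E) (M : K) : 0 <= M ->
  (forall x, `|phi x| <= M * `|x|) -> dual_norm phi <= M.
Proof.
move=> M0 phiM; apply: (dual_norm_sup phi).2 => _ [x /= x1 <-].
by apply: le_trans (phiM x) _; rewrite -[leRHS]mulr1 ler_wpM2l.
Qed.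

Lemma dual_norm_triangle (phi psi : dual hK E) :
  dual_norm (phi + psi) <= dual_norm phi + dual_norm psi.
Proof.
apply: dual_norm_least; first by rewrite addr_ge0 ?dual_norm_ge0.
move=> x; rewrite mulrDl; apply: le_trans (ler_normD _ _) _.
by rewrite lerD ?dual_norm_le.
Qed.

Lemma dual_normZ (l : K) (phi : dual hK E) :
  dual_norm (l *: phi) = `|l| * dual_norm phi.
Proof.
have leZ (k : K) (psi : dual hK E) : dual_norm (k *: psi) <= `|k| * dual_norm psi.
  apply: dual_norm_least; first by rewrite mulr_ge0 ?dual_norm_ge0.
  by move=> x; rewrite [_ x]/(k *: psi x) normrZ -mulrA ler_wpM2l ?dual_norm_le.
apply/eqP; rewrite eq_le leZ /=.
have [->|l0] := eqVneq l 0; first by rewrite normr0 mul0r dual_norm_ge0.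
have := leZ l^-1 (l *: phi); rewrite scalerA mulVf // scale1r normfV.
by rewrite ler_pdivlMl // normr_gt0.
Qed.

Lemma dual_norm_eq0 (phi : dual hK E) : dual_norm phi = 0 -> phi = 0.
Proof.
move=> phi0; apply/val_inj/funext => x /=; apply/eqP; rewrite -normr_le0.
by have := dual_norm_le phi x; rewrite phi0 mul0r.
Qed.

HB.instance Definition _ := Lmodule_isNormed.Build K (dual hK E)
  dual_norm_triangle dual_normZ dual_norm_eq0.

Lemma dual_complete (G : set_system (dual hK E)) :
  ProperFilter G -> cauchy G -> cvg G.
Proof.
move=> GG Gc.
have Gex (e : K) : 0 < e -> exists phi : dual hK E, G [set psi | dual_norm (phi - psi) < e].
  move=> e0; have [phi Gphi] := (cauchyP G).1 Gc e e0; exists phi.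
  by move: Gphi; rewrite -ball_normE.
have Gx x : cvg ((fun phi : dual hK E => phi x : K^o) @ G).
  apply: (real_or_complex_complete hK); apply: cauchy_exP => e e0.
  have x1 : 0 < `|x| + 1 by rewrite ltr_wpDl.
  have [phi Gphi] := Gex _ (divr_gt0 e0 x1).
  exists (phi x).
  apply: (@filterS _ G _ _ ((fun psi : dual hK E => psi x : K^o) @^-1` ball (phi x : K^o) e) _ Gphi).
  move=> psi /=; rewrite -ball_normE /= => h.
  rewrite -[_ - _]/((phi - psi : dual hK E) x).
  apply: le_lt_trans (dual_norm_le _ _) _.
  apply: (@le_lt_trans _ _ (dual_norm (phi - psi) * (`|x| + 1))).
    by rewrite ler_wpM2l ?dual_norm_ge0 // lerDl ler01.
  by rewrite -ltr_pdivlMr.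
pose g x : K^o := lim ((fun phi : dual hK E => phi x : K^o) @ G).
have gl : linear g.
  move=> a x y; apply: cvg_lim; first exact: norm_hausdorff.
  have -> : (fun phi : dual hK E => phi (a *: x + y) : K^o) =
            (fun phi : dual hK E => a *: (phi x : K^o) + phi y).
    by apply/funext => phi; rewrite linearP.
  by apply: cvgD; [apply: cvgZ; [exact: cvg_cst|exact: Gx]|exact: Gx].
have gE (phi : dual hK E) (e : K) : 0 < e ->
    G [set psi | dual_norm (phi - psi) < e] ->
    forall x, `|phi x - g x| <= e * `|x|.
  move=> e0 Ge x; apply/ler_addgt0Pr => d d0.
  have /cvgrPdist_lt/(_ d d0) Gd := Gx x.
  near G => psi.
  have -> : phi x - g x = (phi - psi : dual hK E) x + (psi x - g x).
    by rewrite addrA subrK.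
  apply: le_trans (ler_normD _ _) _; rewrite lerD //.
    apply: le_trans (dual_norm_le _ _) _; rewrite ler_wpM2r // ltW //.
    by near: psi.
  by rewrite distrC ltW //; near: psi.
have gb : exists M : K, forall x, `|g x| <= M * `|x|.
  have [phi Gphi] := Gex _ ltr01.
  exists (1 + dual_norm phi) => x.
  have -> : g x = - (phi x - g x) + phi x by rewrite opprB subrK.
  apply: le_trans (ler_normD _ _) _; rewrite normrN mulrDl lerD ?dual_norm_le //.
  exact: gE.
have gop : g \in @is_operator K E K^o by apply: mem_set.
pose G0 : dual hK E := Operator gop.
apply/cvg_ex; exists G0; apply/cvgrPdist_le => e e0.
have e20 : 0 < e / 2 by rewrite divr_gt0.
have [phi Gphi] := Gex _ e20.
have gphi := gE _ _ e20 Gphi.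
apply: filterS Gphi => psi /= /ltW h.
apply: dual_norm_least; first exact: ltW.
move=> x.
have -> : (G0 - psi : dual hK E) x = - (phi x - g x) + (phi - psi : dual hK E) x.
  by rewrite opprB addrA subrK.
apply: le_trans (ler_normD _ _) _; rewrite [e]splitr mulrDl normrN.
apply: lerD; first exact: gphi.
by apply: le_trans (dual_norm_le _ _) _; rewrite ler_wpM2r.
Unshelve. all: by end_near. Qed.

HB.instance Definition _ := Uniform_isComplete.Build (dual hK E) dual_complete.

End DualNorm.

Section Adjoint.
Variables (R : realType) (K : numFieldType) (hK : real_or_complex R K).
Variables (E F : normedModType K) (T : operator E F).

Lemma comp_is_operator (phi : operator F K^o) :
  (phi \o T) \in @is_operator K E K^o.
Proof.
apply: mem_set; split; first by move=> a x y; rewrite /= !linearP.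
have [M M0 phiM] := operator_bound phi.
have [N N0 TN] := operator_bound T.
exists (M * N) => x /=; apply: le_trans (phiM _) _.
by rewrite -mulrA ler_wpM2l.
Qed.

Definition adjoint_fun (phi : dual hK F) : dual hK E :=
  Operator (comp_is_operator phi).

Lemma adjoint_is_operator : adjoint_fun \in @is_operator K (dual hK F) (dual hK E).
Proof.
apply: mem_set; split; first by move=> a phi psi; exact/val_inj.
have [N N0 TN] := operator_bound T.
exists N => phi; apply: dual_norm_least; first by rewrite mulr_ge0.
move=> x; apply: le_trans (dual_norm_le phi (T x)) _.
rewrite -[`|phi|]/(dual_norm phi) [N * _]mulrC -mulrA.
by apply: ler_wpM2l; [exact: dual_norm_ge0|exact: TN].
Qed.

Definition adjoint : operator (dual hK F) (dual hK E) :=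
  Operator adjoint_is_operator.

End Adjoint.

Record closed_subspace (K : numFieldType) (F : normedModType K) :=
  ClosedSubspace {
    closed_subspace_pred :> submodClosed F;
    closed_subspaceP : closed [set` closed_subspace_pred] }.

Record elt_of (K : numFieldType) (F : normedModType K)
  (Z : closed_subspace F) := EltOf { elt_val : F; elt_valP : elt_val \in Z }.

Section ClosedSubspace.
Variables (K : numFieldType) (F : normedModType K) (Z : closed_subspace F).

HB.instance Definition _ := [isSub for @elt_val K F Z].
HB.instance Definition _ := [Choice of elt_of Z by <:].
HB.instance Definition _ := [SubChoice_isSubLmodule of elt_of Z by <:].

Definition elt_norm (u : elt_of Z) : K := `|elt_val u|.

Lemma elt_norm_triangle u v : elt_norm (u + v) <= elt_norm u + elt_norm v.
Proof. exact: ler_normD. Qed.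

Lemma elt_normZ (l : K) u : elt_norm (l *: u) = `|l| * elt_norm u.
Proof. exact: normrZ. Qed.

Lemma elt_norm_eq0 u : elt_norm u = 0 -> u = 0.
Proof. by move=> /normr0_eq0 u0; exact: val_inj. Qed.

HB.instance Definition _ := Lmodule_isNormed.Build K (elt_of Z)
  elt_norm_triangle elt_normZ elt_norm_eq0.

End ClosedSubspace.

Section ClosedSubspaceComplete.
Variables (K : numFieldType) (F : completeNormedModType K).
Variable Z : closed_subspace F.

Lemma elt_of_complete (G : set_system (elt_of Z)) :
  ProperFilter G -> cauchy G -> cvg G.
Proof.
move=> GG Gc.
have cG : cvg (@elt_val K F Z @ G).
  apply: cauchy_cvg; apply: cauchy_exP => e e0.
  have [u Gu] := (cauchyP G).1 Gc e e0; exists (elt_val u).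
  apply: (@filterS _ G _ _ (@elt_val K F Z @^-1` ball (elt_val u) e) _ Gu).
  by move=> v; rewrite -!ball_normE.
have Zl : lim (@elt_val K F Z @ G) \in Z.
  apply: (@closed_cvg _ _ G _ (@elt_val K F Z) [set` Z]).
  - exact: closed_subspaceP.
  - by apply: nearW => u; exact: elt_valP.
  - exact: cG.
apply/cvg_ex; exists (EltOf Zl); apply/cvgrPdist_lt => e e0.
by have /cvgrPdist_lt/(_ e e0) := cG.
Qed.

HB.instance Definition _ :=
  Uniform_isComplete.Build (elt_of Z) elt_of_complete.

End ClosedSubspaceComplete.

(* Coarsest topology on [E] making every bounded linear functional continuous. *)
Definition weak (K : numFieldType) (E : normedModType K) : topologicalType :=
  sup_topology (fun phi : operator E K^o =>
    Topological.class (initial_topology (phi : E -> K^o))).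

Definition weakly_compact (K : numFieldType) (E : normedModType K)
  (A : set E) : Prop := compact (A : set (weak E)).

Definition linear_span (K : numFieldType) (E : normedModType K)
  (A : set E) : set E :=
  [set x | exists n (a : 'I_n -> K) (v : 'I_n -> E),
     (forall i, A (v i)) /\ x = \sum_i a i *: v i].

Definition WCG_space (K : numFieldType) (E : completeNormedModType K) : Prop :=
  exists A : set E, weakly_compact A /\ dense (linear_span A).

Definition operator_class (K : numFieldType) : Type :=
  forall E F : completeNormedModType K, set (operator E F).

Definition WCG (K : numFieldType) : operator_class K := fun E F T =>
  exists Z : closed_subspace F, WCG_space (elt_of Z) /\ forall x, T x \in Z.

Definition symmetric_class (R : realType) (K : numFieldType)
  (hK : real_or_complex R K) (I : operator_class K) : Prop :=
  forall (E F : completeNormedModType K) (T : operator E F),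
    I E F T -> I (dual hK F) (dual hK E) (adjoint hK T).

(* Main.v *)
(* Both examples are built on l^1. For a separable space such as l^1(N), the
   identity is weakly compactly generated, but its adjoint is the identity of
   l^oo, which is not: a weakly compact subset of a space with a countable
   separating family of functionals is separable, by Hahn-Banach.
   Conversely, index N by the finite binary words; the branches of the binary
   tree give a family of 2^N almost disjoint subsets A_x of N. Let T map the
   basis vector e_x of l^1(2^N) to the indicator of A_x in l^oo(N). The range
   of T is not separable, so T is not weakly compactly generated. For a
   functional Phi on l^oo(N), almost disjointness forces Phi(1_(A_x)) to be the
   sum of the Phi({s}) for s in A_x plus a term in c_0(2^N); hence T^* takes its
   values in the sum of a separable subspace and c_0(2^N), which generates a
   WCG space. *)

Require Import Defs.
From HB Require Import structures.
From mathcomp Require Import all_boot all_order all_algebra.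
From mathcomp Require Import complex ring lra.
From mathcomp Require Import all_classical all_reals all_analysis.

Set Implicit Arguments.
Unset Strict Implicit.
Unset Printing Implicit Defensive.

Import Order.TTheory GRing.Theory Num.Theory.
Import numFieldNormedType.Exports.

Local Open Scope classical_set_scope.
Local Open Scope ring_scope.

(** * Hahn-Banach separation *)

Section HahnBanach.
Variables (R : realType) (V : lmodType R).
Implicit Types (p q f : V -> R) (x y z : V) (t : R).

Lemma le_inf_add (A B : set R) (c : R) : A !=set0 -> B !=set0 ->
  (forall a b, A a -> B b -> c <= a + b) -> c <= inf A + inf B.
Proof.
move=> A0 B0 AB; rewrite addrC -lerBlDr; apply: lb_le_inf => // b Bb.
rewrite lerBlDr addrC -lerBlDr; apply: lb_le_inf => // a Aa.
by rewrite lerBlDr; exact: AB.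
Qed.

Definition sublinear q :=
  (forall x y, q (x + y) <= q x + q y) /\
  (forall t x, 0 <= t -> q (t *: x) <= t * q x).

Lemma sublinear0 q : sublinear q -> q 0 = 0.
Proof.
move=> [qD qZ]; apply/eqP; rewrite eq_le.
have := qZ 0 0 (lexx _); rewrite scale0r mul0r => -> /=.
by have := qD 0 0; rewrite addr0 lerDl.
Qed.

Lemma sublinearN q x : sublinear q -> - q (- x) <= q x.
Proof.
move=> hq; rewrite -subr_ge0 opprK.
by have := hq.1 x (- x); rewrite subrr (sublinear0 hq).
Qed.

Lemma sublinearZ q t x : sublinear q -> 0 <= t -> q (t *: x) = t * q x.
Proof.
move=> hq; rewrite le_eqVlt => /predU1P[<-|t0].
  by rewrite scale0r mul0r sublinear0.
apply/eqP; rewrite eq_le (hq.2 _ _ (ltW t0)) /=.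
have ti : 0 <= t^-1 by rewrite invr_ge0 ltW.
by have := hq.2 _ (t *: x) ti; rewrite scalerK ?lt0r_neq0 // ler_pdivlMl.
Qed.

(** Zorn's lemma for the sublinear functionals below [p]. The pointwise infimum along a chain is
    again sublinear, since the smaller of two members serves both arguments, and [- p (- x)] bounds
    it from below. *)
Lemma minimal_sublinear p : sublinear p -> exists q,
  [/\ sublinear q, forall x, q x <= p x &
      forall r, sublinear r -> (forall x, r x <= q x) -> r = q].
Proof.
move=> hp.
pose T := {q | sublinear q /\ forall x, q x <= p x}.
(* The order is reversed, so that a maximal element is a minimal functional. *)
pose le (q r : T) := `[< forall x, sval r x <= sval q x >].
have [||||q qmin] := @Zorn T le.
- by move=> q; apply/asboolP.
- move=> q r s /asboolP h1 /asboolP h2; apply/asboolP => x.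
  exact: le_trans (h2 x) (h1 x).
- move=> [q hq] [r hr] /asboolP h1 /asboolP h2; apply/eq_exist/funext => x.
  by apply/eqP; rewrite eq_le h1 h2.
- move=> A Atot; have [A0|/set0P/negP/negPn/eqP A0] := pselect (A !=set0); last first.
    have hpp : sublinear p /\ forall x, p x <= p x by [].
    by exists (exist _ p hpp) => s; rewrite A0.
  pose S x := [set sval q x | q in A].
  have S0 x : S x !=set0 by case: A0 => q Aq; exists (sval q x), q.
  have Slb x : has_lbound (S x).
    exists (- p (- x)) => _ [[q [hq qp]] Aq <-] /=.
    by apply: le_trans (sublinearN x hq); rewrite lerN2.
  have Sle (q : T) x : A q -> inf (S x) <= sval q x.
    by move=> Aq; apply: ge_inf => //; exists q.
  pose i x := inf (S x).
  have hi : sublinear i /\ forall x, i x <= p x.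
    split; first split.
    + move=> x y; apply: le_inf_add => // _ _ [q Aq <-] [r Ar <-].
      have [[qD _] _] := svalP q; have [[rD _] _] := svalP r.
      case: (Atot q r Aq Ar) => /asboolP h.
      * by apply: le_trans (Sle r _ Ar) _; apply: le_trans (rD _ _) _; rewrite lerD.
      * by apply: le_trans (Sle q _ Aq) _; apply: le_trans (qD _ _) _; rewrite lerD.
    + move=> t x; rewrite le_eqVlt => /predU1P[<-|t0].
        have [q Aq] := A0; apply: le_trans (Sle q _ Aq) _.
        have [[_ qZ] _] := svalP q.
        by apply: le_trans (qZ _ _ (lexx 0)) _; rewrite !mul0r.
      rewrite -ler_pdivrMl //; apply: lb_le_inf => // _ [q Aq <-].
      rewrite ler_pdivrMl //; apply: le_trans (Sle q _ Aq) _.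
      by have [[_ qZ] _] := svalP q; apply: qZ; exact: ltW.
    + move=> x; have [q Aq] := A0; apply: le_trans (Sle q _ Aq) _.
      by have [_ ->] := svalP q.
  by exists (exist _ i hi) => q Aq; apply/asboolP => x /=; exact: Sle.
exists (sval q); have [hq qp] := svalP q; split => // r hr rq.
have hrp : sublinear r /\ forall x, r x <= p x.
  by split => // x; apply: le_trans (rq x) (qp x).
by have /(congr1 sval) := qmin (exist _ r hrp) (asboolT rq).
Qed.

(** For sublinear [q], taking [t = 0] shows that the shift lies below [q], and [t = 1] that its
    value at [- z] is at most [- q z]. *)
Definition sublinear_shift q z x : R :=
  inf [set q (x + t *: z) - t * q z | t in [set t | 0 <= t]].

Lemma sublinear_shift_le q z x t : sublinear q -> 0 <= t ->
  sublinear_shift q z x <= q (x + t *: z) - t * q z.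
Proof.
move=> hq t0; apply: ge_inf; last by exists t.
exists (- q (- x)) => _ [s /= s0 <-].
by have := hq.1 (- x) (x + s *: z); rewrite addKr sublinearZ //; lra.
Qed.

Lemma sublinear_shift_sublinear q z : sublinear q ->
  sublinear (sublinear_shift q z).
Proof.
move=> hq; have [qD qZ] := hq.
have S0 x : [set q (x + t *: z) - t * q z | t in [set t | 0 <= t]] !=set0.
  by exists (q (x + 0 *: z) - 0 * q z), 0 => /=.
split => [x y|t x].
  apply: le_inf_add => // _ _ [s /= s0 <-] [t /= t0 <-].
  apply: le_trans (sublinear_shift_le _ _ hq (addr_ge0 s0 t0)) _.
  have := qD (x + s *: z) (y + t *: z).
  by rewrite addrACA -scalerDl; lra.
rewrite le_eqVlt => /predU1P[<-|t0].
  have := sublinear_shift_le z (0 *: x) hq (lexx 0).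
  by rewrite !scale0r addr0 (sublinear0 hq) !mul0r subr0.
rewrite -ler_pdivrMl //; apply: lb_le_inf => // _ [s /= s0 <-].
rewrite ler_pdivrMl //.
apply: le_trans (sublinear_shift_le _ _ hq (mulr_ge0 (ltW t0) s0)) _.
rewrite -scalerA -scalerDr mulrBr mulrA lerD2r; exact: qZ (ltW t0).
Qed.

(* A minimal sublinear functional coincides with each of its shifts, which
   makes it additive. *)
Lemma hahn_banach p z : sublinear p -> exists f,
  [/\ forall t x y, f (t *: x + y) = t * f x + f y,
      forall x, f x <= p x & f z = p z].
Proof.
move=> hp; have hs := sublinear_shift_sublinear z hp.
have shift_le q x y : sublinear q -> sublinear_shift q y x <= q x.
  move=> hq; apply: le_trans (sublinear_shift_le _ _ hq (lexx 0)) _.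
  by rewrite scale0r addr0 mul0r subr0.
have [f [hf fs fmin]] := minimal_sublinear hs.
have fp x : f x <= p x by apply: le_trans (fs x) (shift_le _ _ _ hp).
have fD x y : f (x + y) = f x + f y.
  apply/eqP; rewrite eq_le hf.1 /=.
  (* By minimality [f] equals its shift by [y], so [t = 1] gives [f x + f y <= f (x + y)]. *)
  have E := fmin _ (sublinear_shift_sublinear y hf) (fun x => shift_le f x y hf).
  have := sublinear_shift_le y x hf ler01; rewrite E scale1r mul1r.
  by rewrite lerBrDr.
have f0 := sublinear0 hf.
have fN x : f (- x) = - f x.
  by apply/eqP; rewrite -addr_eq0 addrC -fD subrr f0.
exists f; split => //.
  move=> t x y; rewrite fD; congr (_ + _).
  have [t0|t0] := leP 0 t; first exact: sublinearZ.
  by rewrite -[t]opprK scaleNr fN sublinearZ ?oppr_ge0 ?(ltW t0) // !mulNr.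
(* [f] was chosen below the shift of [p] by [z], so [f (- z) <= - p z]. *)
apply/eqP; rewrite eq_le fp /= -lerN2 -fN.
apply: le_trans (fs _) _.
apply: le_trans (sublinear_shift_le _ _ hp ler01) _.
by rewrite scale1r addNr (sublinear0 hp) mul1r sub0r.
Qed.

(** Hahn-Banach applied to the [N]-distance to the subspace [M], which is sublinear, at most [N],
    zero on [M], and at least [e] at [z]. *)
Lemma seminorm_separation (N : V -> R) (M : set V) (z : V) (e : R) :
  (forall x y, N (x + y) <= N x + N y) ->
  (forall t x, N (t *: x) = `|t| * N x) ->
  M 0 -> (forall t x y, M x -> M y -> M (t *: x + y)) ->
  0 < e -> (forall m, M m -> e <= N (z - m)) ->
  exists f, [/\ forall t x y, f (t *: x + y) = t * f x + f y,
    forall x, f x <= N x, forall m, M m -> f m = 0 & 0 < f z].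
Proof.
move=> ND NZ M0 ML e0 zM.
have N0 x : 0 <= N x.
  have := ND x (- x); rewrite subrr -(scale0r (0 : V)) NZ normr0 mul0r -scaleN1r NZ.
  by rewrite normrN1 mul1r; lra.
pose S x := [set N (x - m) | m in M]; pose p x := inf (S x).
have S0 x : S x !=set0 by exists (N (x - 0)), 0.
have Sle x m : M m -> p x <= N (x - m).
  by move=> Mm; apply: ge_inf; [exists 0 => _ [? _ <-] | exists m].
have MZ t m : M m -> M (t *: m) by move=> Mm; rewrite -[_ *: _]addr0; exact: ML.
have hp : sublinear p.
  split => [x y|t x].
    apply: le_inf_add => // _ _ [m Mm <-] [n Mn <-].
    apply: le_trans (Sle _ (m + n) _) _; first by rewrite -[m]scale1r; exact: ML.
    by rewrite opprD addrACA.
  rewrite le_eqVlt => /predU1P[<-|t0].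
    have := Sle (0 *: x) 0 M0; rewrite scale0r subrr -(scale0r (0 : V)) NZ.
    by rewrite normr0 !mul0r scale0r.
  rewrite -ler_pdivrMl //; apply: lb_le_inf => // _ [m Mm <-].
  rewrite ler_pdivrMl //; apply: le_trans (Sle _ _ (MZ t m Mm)) _.
  by rewrite -scalerBr NZ gtr0_norm.
have [f [fL fp fz]] := hahn_banach z hp.
have f0 : f 0 = 0 by have := fL (-1) 0 0; rewrite scaler0 addr0; lra.
have fN x : f (- x) = - f x.
  by have := fL (-1) x 0; rewrite scaleN1r !addr0 f0; lra.
have fM m : M m -> f m <= 0.
  move=> Mm; apply: le_trans (fp m) _; apply: le_trans (Sle m m Mm) _.
  by rewrite subrr -(scale0r (0 : V)) NZ normr0 mul0r.
exists f; split => //.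
- move=> x; apply: le_trans (fp x) _.
  by apply: le_trans (Sle x 0 M0) _; rewrite subr0.
- move=> m Mm; apply/eqP; rewrite eq_le fM //= -oppr_le0 -fN fM //.
  by rewrite -scaleN1r; exact: MZ.
- rewrite fz; apply: lt_le_trans e0 _; apply: lb_le_inf => // _ [m Mm <-].
  exact: zM.
Qed.

End HahnBanach.

(** * Archimedean property and separability of the scalar field *)

Section Scalars.
Variables (R : realType) (K : numFieldType) (hK : real_or_complex R K).

Lemma scalar_archimedean (x : K) : 0 <= x -> exists n : nat, x < n%:R.
Proof.
case: K / hK x => x x0; first by exists (Num.bound x); exact: archi_boundP.
exists (Num.bound (complex.Re x)).
move: x0; case: x => a b /=; rewrite lecE /= => /andP[/eqP -> a0].
rewrite -(rmorph_nat (real_complex R)) ltcE /= eqxx /=.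
exact: archi_boundP.
Qed.

Lemma scalar_separable : exists q : nat -> K,
  forall z e, 0 < e -> exists n, `|z - q n| < e.
Proof.
have ratd (z e : R) : 0 < e -> exists r : rat, `|z - ratr r| < e.
  move=> e0; have [r] := @rat_in_itvoo R (z - e) (z + e) ltac:(lra).
  by rewrite in_itv /= => /andP[h1 h2]; exists r; rewrite ltr_norml; lra.
case: K / hK.
  exists (fun n => ratr (odflt 0 (unpickle n))) => z e e0.
  by have [r hr] := ratd z e e0; exists (pickle r); rewrite pickleK.
exists (fun n => let p : rat * rat := odflt (0, 0) (unpickle n) in
  (ratr p.1 +i* ratr p.2)%C) => -[a b] [e e'].
rewrite ltcE /= => /andP[/eqP -> e0].
have e20 : 0 < e / 2 by rewrite divr_gt0.
have [r hr] := ratd a _ e20; have [s hs] := ratd b _ e20.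
exists (pickle (r, s)); rewrite pickleK /= ltcE /= eqxx /=.
rewrite -ltr_sqr ?nnegrE ?sqrtr_ge0 ?ltW // sqr_sqrtr ?addr_ge0 ?sqr_ge0 //.
rewrite -[X in X + _]real_normK ?num_real // -[X in _ + X]real_normK ?num_real //.
have := normr_ge0 (a - ratr r); have := normr_ge0 (b - ratr s).
nra.
Qed.

End Scalars.

(** A type alias, so that a complex vector space can also carry a real scalar multiplication, to
    which the real Hahn-Banach theorem applies. *)
Definition realify (R : rcfType) (V : Type) : Type := V.

Section Realify.
Variables (R : rcfType) (V : lmodType R[i]).

HB.instance Definition _ := GRing.Zmodule.on (realify R V).

Definition realify_scale (r : R) (v : realify R V) : realify R V :=
  (r%:C)%C *: (v : V).

Lemma realify_scaleA a b v :
  realify_scale a (realify_scale b v) = realify_scale (a * b) v.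
Proof. by rewrite /realify_scale scalerA rmorphM. Qed.

Lemma realify_scale1 : left_id 1 realify_scale.
Proof. by move=> v; rewrite /realify_scale rmorph1 scale1r. Qed.

Lemma realify_scaleDr : right_distributive realify_scale +%R.
Proof. by move=> a u v; rewrite /realify_scale scalerDr. Qed.

Lemma realify_scaleDl v : {morph realify_scale^~ v : a b / a + b}.
Proof. by move=> a b; rewrite /realify_scale rmorphD scalerDl. Qed.

HB.instance Definition _ := GRing.Zmodule_isLmodule.Build R (realify R V)
  realify_scaleA realify_scale1 realify_scaleDr realify_scaleDl.

End Realify.

(** For complex scalars, separate over the reals first and recover a complex-linear functional from
    its real part. It vanishes on [M] because [M] is stable under multiplication by i. *)
Lemma separation (R : realType) (K : numFieldType) (hK : real_or_complex R K)
    (V : normedModType K) (M : set V) (z : V) (e : K) :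
  M 0 -> (forall a x y, M x -> M y -> M (a *: x + y)) ->
  0 < e -> (forall m, M m -> e <= `|z - m|) ->
  exists phi : operator V K^o, (forall m, M m -> phi m = 0) /\ phi z <> 0.
Proof.
case: K / hK V M z e => V M z e M0 ML e0 zM.
  have [f [fL fN fM fz]] := seminorm_separation
    (@ler_normD _ V) (@normrZ _ V) M0 ML e0 zM.
  have fop : f \in @is_operator R V R^o.
    apply: mem_set; split; first exact: fL.
    exists 1 => x; rewrite mul1r ler_norml fN andbT lerNl -normrN.
    have fNx : - f x = f (- x).
      by have := fL (-1) x 0; rewrite addr0 scaleN1r (fM _ M0) addr0 mulN1r.
    by rewrite fNx fN.
  exists (Operator fop); split => //.
  by move=> /eqP; rewrite /= gt_eqF.
pose N (v : realify R V) : R := complex.Re `|v : V|.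
have nRe (v : V) : `|v| = ((complex.Re `|v|)%:C)%C.
  have := normr_ge0 v; case: `|v| => a b.
  by rewrite lecE /= => /andP[/eqP -> _].
have leC (a b : R) : ((a%:C)%C <= (b%:C)%C :> R[i]) = (a <= b) by rewrite lecR.
have ND (x y : realify R V) : N (x + y) <= N x + N y.
  by rewrite -leC rmorphD /= -!nRe; exact: ler_normD.
have NZ (t : R) (x : realify R V) : N (t *: x) = `|t| * N x.
  rewrite /N -[t *: x]/((t%:C)%C *: (x : V)) normrZ normc_def /= expr0n /=.
  by rewrite addr0 sqrtr_sqr [in LHS]nRe -rmorphM.
have ML' (t : R) (x y : realify R V) : M x -> M y -> M (t *: x + y).
  exact: ML.
have e0' : 0 < complex.Re e by move: e0; rewrite ltcE => /andP[].
have zM' (m : realify R V) : M m -> complex.Re e <= N ((z : realify R V) - m).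
  by move=> /zM; rewrite lecE => /andP[].
have [f [fL fN fM fz]] := seminorm_separation ND NZ M0 ML' e0' zM'.
have f0 : f 0 = 0 by exact: fM.
have fD (x y : V) : f (x + y) = f x + f y.
  by have := fL 1 x y; rewrite scale1r mul1r.
have fZ (t : R) (x : V) : f ((t%:C)%C *: x) = t * f x.
  by have := fL t x 0; rewrite !addr0 f0 addr0.
have fNx (x : V) : f (- x) = - f x.
  by rewrite -scaleN1r -(mulN1r (f x)) -fZ rmorphN1.
have fabs (x : V) : `|f x| <= N x.
  rewrite ler_norml fN andbT lerNl -fNx.
  by apply: le_trans (fN _) _; rewrite /N normrN.
(* The only complex-linear functional with real part [f]. *)
pose g (v : V) : R[i]^o := (f v +i* (- f ('i%C *: v)))%C.
have gop : g \in @is_operator R[i] V R[i]^o.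
  apply: mem_set; split.
    have fC (a b : R) (x : V) : f ((a +i* b)%C *: x) = a * f x + b * f ('i%C *: x).
      have -> : (a +i* b)%C = (a%:C)%C + (b%:C)%C * 'i%C.
        apply/eqP; rewrite eq_complex /=.
        by apply/andP; split; apply/eqP; ring.
      by rewrite scalerDl fD -scalerA !fZ.
    move=> [a b] x y; apply/eqP; rewrite eq_complex /= scalerDr !fD scalerA.
    have -> : ('i * (a +i* b) = (- b) +i* a)%C.
      by apply/eqP; rewrite eq_complex /=; apply/andP; split; apply/eqP; ring.
    by rewrite (fC a b) (fC (- b) a); apply/andP; split; apply/eqP; ring.
  (* Both [f x] and [f ('i%C *: x)] are at most [N x] in absolute value, whence the crude constant
     2. *)
  exists 2 => x.
  have iN : N ('i%C *: x) = N x.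
    have ni : `|'i%C : R[i]| = 1.
      by rewrite normc_def /= expr0n /= expr1n add0r sqrtr1.
    by rewrite /N normrZ ni mul1r.
  have -> : g x = ((f x)%:C)%C - ((f ('i%C *: x))%:C)%C * 'i%C.
    apply/eqP; rewrite eq_complex /=.
    by apply/andP; split; apply/eqP; ring.
  have nr (u : R) : `|(u%:C)%C : R[i]| = (`|u|%:C)%C.
    by rewrite normc_def /= expr0n /= addr0 sqrtr_sqr.
  have ni : `|'i%C : R[i]| = 1.
    by rewrite normc_def /= expr0n /= expr1n add0r sqrtr1.
  apply: le_trans (ler_normB _ _) _; rewrite normrM ni mulr1 !nr.
  rewrite mulr2n mulrDl mul1r (nRe x) lerD // leC //.
  by apply: le_trans (fabs _) _; rewrite iN.
exists (Operator gop); split => [m Mm|].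
  rewrite /= /g !fM //; last by rewrite -[_ *: _]addr0; exact: ML.
  by rewrite oppr0.
by move=> /(congr1 (@complex.Re R)) /= h; move: fz; rewrite h ltxx.
Qed.

(** * Closed spans and bounded functions *)

Lemma closure_normP (K : numFieldType) (V : normedModType K) (A : set V) (x : V) :
  closure A x <-> forall e, 0 < e -> exists2 y, A y & `|x - y| < e.
Proof.
split=> [Ax e e0|h B /nbhs_ballP[e /= e0 eB]].
  have [y [Ay]] := Ax _ (nbhsx_ballx x e e0).
  by rewrite -ball_normE /= => xy; exists y.
have [y Ay xy] := h e e0; exists y; split => //; apply: eB.
by rewrite -ball_normE.
Qed.

Lemma dense_closureP (X : topologicalType) (A : set X) :
  dense A <-> forall x, closure A x.
Proof.
split=> [dA x B Bx|cA O [x Ox] Oo].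
  have [|y [/interior_subset By Ay]] := dA (B^°) _ (@open_interior _ B).
    by exists x.
  by exists y.
by have [y [Ay Oy]] := cA x O (open_nbhs_nbhs (conj Oo Ox)); exists y.
Qed.

Section Span.
Variables (K : numFieldType) (V : normedModType K) (S : set V).

Lemma linear_span0 : linear_span S 0.
Proof.
exists 0%N, (fun _ => 0), (fun _ => 0); split; first by case.
by rewrite big_ord0.
Qed.

Lemma linear_spanP a x y :
  linear_span S x -> linear_span S y -> linear_span S (a *: x + y).
Proof.
move=> [n [b [v [vS ->]]]] [m [c [w [wS ->]]]].
exists (n + m)%N,
  (fun i => match fintype.split i with inl j => a * b j | inr j => c j end),
  (fun i => match fintype.split i with inl j => v j | inr j => w j end); split.
  by move=> i; case: fintype.split.
rewrite big_split_ord /= scaler_sumr; congr (_ + _); apply: eq_bigr => i _.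
  by rewrite (unsplitK (inl i : 'I_n + 'I_m)) scalerA.
by rewrite (unsplitK (inr i : 'I_n + 'I_m)).
Qed.

Lemma mem_linear_span x : S x -> linear_span S x.
Proof.
move=> Sx; exists 1%N, (fun _ => 1), (fun _ => x); split => //.
by rewrite big_ord1 scale1r.
Qed.

Lemma linear_span_sum (J : Type) (s : seq J) (a : J -> K) (w : J -> V) :
  (forall j, linear_span S (w j)) -> linear_span S (\sum_(j <- s) a j *: w j).
Proof.
move=> Sw; elim: s => [|j s IHs]; first by rewrite big_nil; exact: linear_span0.
by rewrite big_cons; exact: linear_spanP.
Qed.

Lemma linear_span_min (P : set V) : P 0 ->
  (forall a x y, P x -> P y -> P (a *: x + y)) -> S `<=` P -> linear_span S `<=` P.
Proof.
move=> P0 PL SP _ [n [a [v [vS ->]]]]; apply: (big_ind P) => //.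
  by move=> x y Px Py; rewrite -[x]scale1r; exact: PL.
by move=> i _; rewrite -[_ *: _]addr0; apply: PL => //; exact: SP.
Qed.

Definition closed_span_pred : {pred V} := mem (closure (linear_span S)).

Lemma closed_span_submod_closed : submod_closed closed_span_pred.
Proof.
split; first by apply: mem_set; apply: subset_closure; exact: linear_span0.
move=> a x y /set_mem /closure_normP hx /set_mem /closure_normP hy.
apply/mem_set/closure_normP => e e0.
(* The summand 1 keeps the denominator positive when [a] is 0. *)
have a1 : 0 < `|a| + 1 by rewrite ltr_wpDl.
have [x' Sx' xx'] := hx (e / 2 / (`|a| + 1)) (divr_gt0 (divr_gt0 e0 (ltr0n _ 2)) a1).
have [y' Sy' yy'] := hy (e / 2) (divr_gt0 e0 (ltr0n _ 2)).
exists (a *: x' + y'); first exact: linear_spanP.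
rewrite opprD addrACA -scalerBr [e]splitr.
apply: le_lt_trans (ler_normD _ _) _; rewrite ler_ltD // normrZ.
apply: (@le_trans _ _ ((`|a| + 1) * `|x - x'|)); first by rewrite ler_wpM2r // lerDl.
by rewrite mulrC -ler_pdivlMr // ltW.
Qed.

HB.instance Definition _ :=
  GRing.isSubmodClosed.Build K V closed_span_pred closed_span_submod_closed.

Lemma closed_closed_span : closed [set` closed_span_pred].
Proof.
have -> : [set` closed_span_pred] = closure (linear_span S).
  by apply/seteqP; split => x; [move/set_mem | move/mem_set].
exact: closed_closure.
Qed.

Definition closed_span : closed_subspace V := ClosedSubspace closed_closed_span.

Lemma closed_spanP x : reflect (closure (linear_span S) x) (x \in closed_span).
Proof. by apply: (iffP idP) => [/set_mem|/mem_set]. Qed.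

Lemma mem_closed_span x : S x -> x \in closed_span.
Proof. by move=> Sx; apply/closed_spanP/subset_closure/mem_linear_span. Qed.

End Span.

Lemma elt_val_is_linear (K : numFieldType) (V : normedModType K)
  (Z : closed_subspace V) : linear (@elt_val K V Z).
Proof. by []. Qed.

HB.instance Definition _ (K : numFieldType) (V : normedModType K)
    (Z : closed_subspace V) :=
  GRing.isLinear.Build K (elt_of Z) V *:%R (@elt_val K V Z)
    (@elt_val_is_linear K V Z).

(** An approximant from the ambient space is a combination of elements of [S], and these already lie
    in the closed span. *)
Lemma linear_span_closed_span_dense (K : numFieldType) (V : normedModType K)
    (S : set V) :
  dense (linear_span [set u : elt_of (closed_span S) | S (elt_val u)]).
Proof.
apply/dense_closureP => u; apply/closure_normP => e e0.
have /closed_spanP/closure_normP/(_ e e0)[y Sy uy] := elt_valP u.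
have [n [a [v [vS yE]]]] := Sy.
pose w i : elt_of (closed_span S) := EltOf (mem_closed_span (vS i)).
exists (\sum_i a i *: w i); first by exists n, a, w.
rewrite [`|_|]/(`|elt_val (u - \sum_i a i *: w i)|).
suff -> : elt_val (u - \sum_i a i *: w i) = elt_val u - y by [].
rewrite linearB linear_sum yE; congr (_ - _); apply: eq_bigr => i _.
Qed.

Section BoundedFunctions.
Variables (R : realType) (K : numFieldType) (hK : real_or_complex R K) (I : Type).

Definition is_bounded : {pred I -> K^o} :=
  mem [set f | exists M : K, forall i, `|f i| <= M].

Record linf := Linf { linf_fun :> I -> K^o; linfP : linf_fun \in is_bounded }.

HB.instance Definition _ := [isSub for linf_fun].
HB.instance Definition _ := [Choice of linf by <:].

Lemma is_bounded_submod_closed : submod_closed is_bounded.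
Proof.
split; first by apply: mem_set; exists 0 => i; rewrite normr0.
move=> a f g /set_mem[M fM] /set_mem[N gN]; apply: mem_set.
exists (`|a| * M + N) => i; apply: le_trans (ler_normD _ _) _.
by rewrite lerD // normrZ ler_wpM2l.
Qed.

HB.instance Definition _ :=
  GRing.isSubmodClosed.Build K (I -> K^o) is_bounded is_bounded_submod_closed.
HB.instance Definition _ := [SubChoice_isSubLmodule of linf by <:].

(* The norm is a supremum in [K], hence depends on [hK]. *)
Definition linf_of (hK : real_or_complex R K) : Type := linf.
HB.instance Definition _ := GRing.Lmodule.on (linf_of hK).

(** 0 is adjoined to the values so that the set is nonempty even when [I] is empty. *)
Definition linf_norm (f : linf_of hK) : K :=
  supremum 0 [set x | x = 0 \/ exists i, x = `|f i| ].

Lemma linf_norm_sup (f : linf_of hK) :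
  supremums [set x | x = 0 \/ exists i, x = `|f i| ] (linf_norm f).
Proof.
rewrite /linf_norm /supremum; set A := (X in X == set0).
have A0 : A !=set0 by exists 0; left.
case: ifPn => [/eqP A0'|_]; first by case: A0 => a; rewrite A0'.
have [M fM] := set_mem (linfP f).
have [m Am] : supremums A !=set0.
  apply: (real_or_complex_supremums hK A0); first by move=> _ [->|[i ->]].
  exists `|M| => _ [->//|[i ->]]; apply: le_trans (fM i) _.
  by rewrite real_ler_norm // ger0_real //; apply: le_trans (fM i).
by case: xgetP => // /(_ m).
Qed.

Lemma linf_norm_ge0 f : 0 <= linf_norm f.
Proof. by apply: (linf_norm_sup f).1; left. Qed.

Lemma linf_norm_le (f : linf_of hK) i : `|f i| <= linf_norm f.
Proof. by apply: (linf_norm_sup f).1; right; exists i. Qed.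

Lemma linf_norm_least (f : linf_of hK) M : 0 <= M ->
  (forall i, `|f i| <= M) -> linf_norm f <= M.
Proof. by move=> M0 fM; apply: (linf_norm_sup f).2 => _ [->//|[i ->]]. Qed.

Lemma linf_norm_triangle (f g : linf_of hK) :
  linf_norm (f + g) <= linf_norm f + linf_norm g.
Proof.
apply: linf_norm_least; first by rewrite addr_ge0 ?linf_norm_ge0.
move=> i; apply: le_trans (ler_normD _ _) _.
by rewrite lerD ?linf_norm_le.
Qed.

Lemma linf_normZ (l : K) (f : linf_of hK) :
  linf_norm (l *: f) = `|l| * linf_norm f.
Proof.
have leZ (k : K) (g : linf_of hK) : linf_norm (k *: g) <= `|k| * linf_norm g.
  apply: linf_norm_least; first by rewrite mulr_ge0 ?linf_norm_ge0.
  by move=> x; rewrite [_ x]/(k *: g x) normrZ ler_wpM2l ?linf_norm_le.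
apply/eqP; rewrite eq_le leZ /=.
have [->|l0] := eqVneq l 0; first by rewrite normr0 mul0r linf_norm_ge0.
have := leZ l^-1 (l *: f); rewrite scalerA mulVf // scale1r normfV.
by rewrite ler_pdivlMl // normr_gt0.
Qed.

Lemma linf_norm_eq0 (f : linf_of hK) : linf_norm f = 0 -> f = 0.
Proof.
move=> f0; apply/val_inj/funext => x /=; apply/eqP; rewrite -normr_le0.
by have := linf_norm_le f x; rewrite f0.
Qed.

HB.instance Definition _ := Lmodule_isNormed.Build K (linf_of hK)
  linf_norm_triangle linf_normZ linf_norm_eq0.

End BoundedFunctions.

(** * The space l^1 *)

Lemma operator_eq0 (K : numFieldType) (V W : normedModType K)
    (phi : operator V W) (S : set V) :
  dense (linear_span S) -> (forall v, S v -> phi v = 0) -> forall v, phi v = 0.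
Proof.
move=> /dense_closureP dS phiS v.
have phi0 : linear_span S `<=` [set v | phi v = 0].
  apply: linear_span_min => [|a x y /= px py|//]; first exact: linear0.
  by rewrite linearP /= px py scaler0 addr0.
have [M M0 phiM] := operator_bound phi.
apply/eqP; rewrite -normr_le0; apply/ler_addgt0Pl => e e0; rewrite addr0.
have M1 : 0 < M + 1 by rewrite ltr_wpDl.
have [y /phi0 /= py vy] := (closure_normP _ _).1 (dS v) _ (divr_gt0 e0 M1).
rewrite -[phi v]subr0 -py -linearB; apply: le_trans (phiM _) _.
apply: (@le_trans _ _ ((M + 1) * `|v - y|)); first by rewrite ler_wpM2r // lerDl.
by rewrite mulrC -ler_pdivlMr // ltW.
Qed.

Lemma operator_linE (K : numFieldType) (V W : normedModType K)
    (a : K) (phi psi : operator V W) x :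
  (a *: phi + psi) x = a *: phi x + psi x.
Proof. by []. Qed.

Section L1.
Variables (R : realType) (K : numFieldType) (hK : real_or_complex R K) (I : Type).

Lemma delta_is_operator (i : I) :
  (fun f : linf_of I hK => f i) \in @is_operator K (linf_of I hK) K^o.
Proof.
apply: mem_set; split; first by [].
by exists 1 => f; rewrite mul1r; exact: linf_norm_le.
Qed.

Definition delta i : dual hK (linf_of I hK) := Operator (delta_is_operator i).

(* Embedding l^1 in the dual of l^oo spares the construction of a completion
   and makes every bounded family the values of a functional on the basis. *)
Definition l1 : completeNormedModType K := elt_of (closed_span (range delta)).

Definition l1_basis (i : I) : l1 := EltOf (mem_closed_span (imageT delta i)).

Lemma l1_basis_norm i : `|l1_basis i| <= 1.
Proof.
apply: dual_norm_least => // f; rewrite mul1r; exact: linf_norm_le.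
Qed.

Lemma l1_basis_dense : dense (linear_span (range l1_basis)).
Proof.
have -> : range l1_basis = [set u : l1 | range delta (elt_val u)].
  apply/seteqP; split => [_ [i _ <-]|u /= [i _ iu]]; first by exists i.
  by exists i => //; exact: val_inj.
exact: linear_span_closed_span_dense.
Qed.

Lemma l1_dual_is_operator (w : linf_of I hK) :
  (fun u : l1 => elt_val u w) \in @is_operator K l1 K^o.
Proof.
apply: mem_set; split.
  by move=> a u v; rewrite linearP; exact: operator_linE.
by exists `|w| => u; rewrite mulrC; exact: (dual_norm_le (elt_val u)).
Qed.

(** Elements of [l1] are functionals on l^oo, so a bounded family [w] acts on them by evaluation at
    [w]; on [l1_basis hK i] this gives [w i]. *)
Definition l1_dual w : dual hK l1 := Operator (l1_dual_is_operator w).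

Lemma l1_dual_ext (phi psi : dual hK l1) :
  (forall i, phi (l1_basis i) = psi (l1_basis i)) -> phi = psi.
Proof.
move=> h; apply/eqP; rewrite -subr_eq0; apply/eqP/val_inj/funext => u.
apply: (operator_eq0 (phi := phi - psi) l1_basis_dense) => _ [i _ <-].
by apply/eqP; rewrite subr_eq0; apply/eqP/h.
Qed.

(** The dual of l^1 is l^oo: the values on the basis form a bounded family [w], and [phi] is
    [l1_dual w] since the two agree on the basis. *)
Lemma l1_dual_norm (phi : dual hK l1) M : 0 <= M ->
  (forall i, `|phi (l1_basis i)| <= M) -> `|phi| <= M.
Proof.
move=> M0 phiM.
have wb : (fun i => phi (l1_basis i)) \in @is_bounded K I by apply: mem_set; exists M.
pose w : linf_of I hK := Linf wb.
have -> : phi = l1_dual w by apply: l1_dual_ext.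
apply: dual_norm_least => // u; apply: le_trans (dual_norm_le (elt_val u) w) _.
have wM : `|w| <= M by exact: linf_norm_least.
apply: le_trans (ler_wpM2l (dual_norm_ge0 (elt_val u)) wM) _.
by rewrite mulrC.
Qed.

(** The universal property of l^1 for dual targets. The family [g] defines an operator [S] from [X]
    to l^oo, sending [x] to the family of all [g i x]; its adjoint maps [delta hK i] to [g i] and is
    restricted to [l1]. *)
Lemma l1_lift (X : normedModType K) (g : I -> dual hK X) M : 0 <= M ->
  (forall i, `|g i| <= M) ->
  exists T : operator l1 (dual hK X), forall i, T (l1_basis i) = g i.
Proof.
move=> M0 gM.
have gxM x i : `|g i x| <= M * `|x|.
  by apply: le_trans (dual_norm_le _ _) _; rewrite ler_wpM2r //; exact: gM.
have Sb x : (fun i => g i x) \in @is_bounded K I.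
  by apply: mem_set; exists (M * `|x|).
pose S x : linf_of I hK := Linf (Sb x).
have Sop : S \in @is_operator K X (linf_of I hK).
  apply: mem_set; split.
    by move=> a x y; apply/val_inj/funext => i; exact: linearP.
  exists M => x; apply: linf_norm_least => //; first by rewrite mulr_ge0.
  exact: gxM.
have Top : (fun u : l1 => adjoint hK (Operator Sop) (elt_val u)) \in
    @is_operator K l1 (dual hK X).
  apply: mem_set; split; first by move=> a x y; rewrite !linearP.
  have [N N0 hN] := operator_bound (adjoint hK (Operator Sop)).
  by exists N => u; exact: hN.
by exists (Operator Top) => i; exact/val_inj.
Qed.

End L1.

(** * Weak compactness *)

Section Weak.
Variables (K : numFieldType) (E : normedModType K).

Lemma weak_cvgP (F : set_system E) (x : E) : Filter F ->
  F --> (x : weak E) <->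
  forall phi : operator E K^o, (phi : E -> K^o) @ F --> phi x.
Proof.
move=> FF; rewrite cvg_sup; split=> h phi.
  by apply: cvg_trans (cvg_app _ (h phi)) _; exact: initial_continuous.
move=> A /= [_ [[B Bop <-] Bx BA]].
by rewrite nbhs_filterE; apply: filterS BA _; apply: h; exact: open_nbhs_nbhs.
Qed.

Lemma weak_continuous (phi : operator E K^o) :
  continuous (phi : weak E -> K^o).
Proof.
move=> x; have := @weak_cvgP (nbhs (x : weak E)) x _.
by case=> + _; apply; exact: cvg_id.
Qed.

(** The hypothesis says that [z] tends weakly to 0 along the cofinite filter. If 0 is no cluster
    point of [F], some member of [F] misses a weak neighbourhood of 0; then [F] contains a finite
    set of values of [z], where it clusters. *)
Lemma weakly_compact_null (J : Type) (z : J -> E) :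
  (forall (phi : operator E K^o) (e : K), 0 < e ->
    finite_set [set j | e <= `|phi (z j)| ]) ->
  weakly_compact (0 |` range z).
Proof.
move=> zfin F FF FA.
have [F0|] := pselect (cluster F (0 : weak E)).
  by exists 0; split => //; left.
move=> /existsNP[P /existsNP[B /not_implyP[FP /not_implyP[B0 PB]]]].
pose G : set_system J := [set Q | finite_set (~` Q)].
have GF : Filter G.
  split; first by rewrite /G /= setCT.
    by move=> Q Q' GQ GQ'; rewrite /G /= setCI finite_setU.
  by move=> Q Q' QQ' /= GQ; apply: sub_finite_set GQ; exact: subsetC.
have GB : G (z @^-1` B).
  have : z @ G --> (0 : weak E).
    apply/weak_cvgP => phi; rewrite linear0.
    apply/cvgrPdist_lt => e e0; apply: sub_finite_set (zfin phi e e0) => j /=.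
    by rewrite sub0r normrN => /negP; rewrite -real_leNgt ?normr_real ?gtr0_real //.
  by apply.
have Dfin : finite_set (z @` (~` (z @^-1` B))) by exact: finite_image.
have FD : F (z @` (~` (z @^-1` B))).
  apply: filterS (filterI FP FA) => v [Pv [v0|[j _ jv]]].
    exfalso; apply: PB; exists v; split => //; rewrite v0.
    exact: (@nbhs_singleton (weak E)).
  by exists j => // Bj; apply: PB; exists v; rewrite -jv in Pv *.
have [v [[j _ jv] Fv]] := @finite_compact (weak E) _ Dfin F FF FD.
by exists v; split => //; right; exists j.
Qed.

End Weak.

Lemma cluster_cvg_eq (T : topologicalType) (K : numFieldType) (F : set_system T)
    (b : T) (g : T -> K^o) (l : K^o) :
  Filter F -> cluster F b -> {for b, continuous g} -> g @ F --> l -> g b = l.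
Proof.
move=> FF Fb gb gl; apply/eqP; rewrite -subr_eq0 -normr_le0.
apply/ler_addgt0Pl => e e0; rewrite addr0.
have e2 : 0 < e / 2 by rewrite divr_gt0.
have /cvgrPdist_lt/(_ _ e2) hb := gb; have /cvgrPdist_lt/(_ _ e2) hl := gl.
have [v [/= h1 h2]] := Fb _ _ hl hb.
rewrite [e]splitr -[g b](subrK (g v)) -addrA.
by apply: le_trans (ler_normD _ _) _; rewrite lerD ?ltW // distrC.
Qed.

Section WeaklyCompactSeparable.
Variables (R : realType) (K : numFieldType) (hK : real_or_complex R K).
Variables (E : normedModType K) (A : set E) (f : nat -> operator E K^o).
Hypothesis wA : weakly_compact A.
Hypothesis fsep : forall v, (forall n, f n v = 0) -> v = 0.

(* On a weakly compact set the weak topology is that of pointwise convergence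
   of the [f n], hence separable; Hahn-Banach turns weak into norm density. *)
Lemma weakly_compact_separable :
  exists d : seq nat -> E, A `<=` closure (linear_span (range d)).
Proof.
have [q qd] := scalar_separable hK.
(* [t] lists codes of approximate values of the first [size t] functionals; [d t] is a point of [A]
   with roughly these values, or 0 if there is none. *)
pose near t (a : E) := forall i, (i < size t)%N ->
  `|f i a - q (nth 0%N t i)| < (size t).+1%:R^-1.
pose d t := xget 0 [set a | A a /\ near t a].
exists d => a Aa.
(* Two points near the same [t] of length [n] differ by less than two error terms on the first [n]
   functionals; this yields a sequence in the range of [d] that imitates [a]. *)
have /choice[a_ a_P] : forall n, exists b, [/\ A b, range d b &
    forall i, (i < n)%N -> `|f i a - f i b| < n.+1%:R^-1 + n.+1%:R^-1].
  move=> n.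
  have [c cP] := choice (fun i => qd (f i a) n.+1%:R^-1 ltac:(by rewrite invr_gt0)).
  pose t := mkseq c n.
  have st : size t = n by rewrite size_mkseq.
  have ta : near t a by move=> i; rewrite st => ni; rewrite nth_mkseq.
  have [Ad td] : A (d t) /\ near t (d t).
    by rewrite /d; apply: (@xgetPex _ 0 [set a | A a /\ near t a]); exists a.
  exists (d t); split => //.
  move=> i ni; rewrite -[f i a](subrK (q (nth 0%N t i))) -addrA.
  apply: le_lt_trans (ler_normD _ _) _; rewrite ltrD //.
    by have := ta i; rewrite st; apply.
  by rewrite distrC; have := td i; rewrite st; apply.
(* Otherwise some [phi] kills every [d t] but not [a]. A weak cluster point [b] of [a_] has the
   values of [a] under all [f n], so [b = a], although [phi b = 0]. *)
apply: contrapT => /closure_normP/existsNP[e /not_implyP[e0 ae]].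
have [phi [phi0 phia]] : exists phi : operator E K^o,
    (forall m, linear_span (range d) m -> phi m = 0) /\ phi a <> 0.
  apply: (separation hK (e := e)) => //; first exact: linear_span0.
    by move=> *; exact: linear_spanP.
  move=> m dm; rewrite real_leNgt ?normr_real ?gtr0_real //.
  by apply/negP => am; apply: ae; exists m.
have [|b [_ Fb]] := wA (F := a_ @ \oo).
  by exists 0%N => // n _; have [] := a_P n.
have FF : ProperFilter (a_ @ \oo : set_system (weak E)) by apply: fmap_proper_filter.
have inv_cvg : (fun n => n.+1%:R^-1 + n.+1%:R^-1 : K^o) @ \oo --> (0 : K^o).
  rewrite -[X in _ --> X]addr0; apply: cvgD; apply/cvgrPdist_lt => eps eps0;
  (have [|N hN] := @scalar_archimedean _ _ hK eps^-1;
     first by rewrite invr_ge0 ltW); exists N => // n /= Nn;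
   rewrite sub0r normrN ger0_norm ?invr_ge0 // invf_plt ?posrE //;
   by apply: lt_le_trans hN _; rewrite ler_nat leqW.
have fb n : f n b = f n a.
  apply: (cluster_cvg_eq FF Fb) => //; first exact: weak_continuous.
  apply/cvgrPdist_lt => eps eps0.
  have /cvgrPdist_lt/(_ _ eps0) := inv_cvg.
  apply: filterS2 (nbhs_infty_gt n) => m nm /=; rewrite sub0r normrN.
  rewrite ger0_norm ?addr_ge0 ?invr_ge0 //; apply: lt_trans.
  by have [_ _] := a_P m; apply.
apply: phia; have <- : b = a.
  by apply/eqP; rewrite -subr_eq0; apply/eqP/fsep => n; rewrite linearB /= fb subrr.
apply: (cluster_cvg_eq FF Fb); first exact: weak_continuous.
have pa : phi \o a_ = cst 0.
  by apply/funext => n; apply: phi0; apply: mem_linear_span; have [] := a_P n.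
by apply: (@cvg_trans _ ((phi \o a_) @ \oo)) => //; rewrite pa; exact: cvg_cst.
Qed.

End WeaklyCompactSeparable.

(** Cantor's diagonal: an injective [p] has a left inverse, and the sequence negating the diagonal
    of that inverse contradicts itself at its own code. *)
Lemma cantor_not_injective (p : (nat -> bool) -> nat) :
  exists x y, x <> y /\ p x = p y.
Proof.
apply: contrapT => h.
have pinj x y : p x = p y -> x = y.
  by move=> pxy; apply: contrapT => xy; apply: h; exists x, y.
pose x n := ~~ xget (fun => true) [set y | p y = n] n.
have : xget (fun => true) [set y | p y = p x] = x.
  by case: xgetP => [y _ /pinj//|/(_ x)]; move=> /(_ erefl).
by move=> /(congr1 (fun u => u (p x))); rewrite /x; case: (xget _ _ _).
Qed.

(** The space is norm separable, since [A] lies in the closed span of countably many vectors.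
    Uncountably many points [g x] cannot all have different approximants in a countable dense set,
    so two of them share one. *)
Lemma WCG_not_discrete (R : realType) (K : numFieldType)
    (hK : real_or_complex R K) (Z : completeNormedModType K)
    (f : nat -> operator Z K^o) (g : (nat -> bool) -> Z) :
  WCG_space Z -> (forall v, (forall n, f n v = 0) -> v = 0) ->
  exists x y, x <> y /\ `|g x - g y| < 1.
Proof.
move=> [A [wA /dense_closureP dA]] fsep.
have [d Ad] := weakly_compact_separable hK wA fsep.
have dZ z : closure (linear_span (range d)) z.
  have : linear_span A `<=` closure (linear_span (range d)).
    apply: linear_span_min => //.
    - by have /closed_spanP := rpred0 (closed_span (range d)).
    - move=> a x y /closed_spanP hx /closed_spanP hy; apply/closed_spanP.
      by rewrite rpredD // rpredZ.
  move=> /closure_subset dA'.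
  by rewrite ((closure_id _).1 (@closed_closure _ (linear_span (range d)))); apply: dA'.
have [q qd] := scalar_separable hK.
(* Combinations of vectors [d t] with coefficients from the dense sequence [q] are coded by a
   countable type. *)
pose comb (c : seq (nat * seq nat)) := \sum_(p <- c) q p.1 *: d p.2.
have combP : linear_span (range d) `<=`
    [set z | forall e, 0 < e -> exists c, `|z - comb c| < e].
  move=> _ [n [a [v [vd ->]]]].
  apply: (big_ind (fun z => forall e, 0 < e -> exists c, `|z - comb c| < e)).
  - by move=> e e0; exists [::]; rewrite /comb big_nil subrr normr0.
  - move=> x y hx hy e e0; have e2 : 0 < e / 2 by rewrite divr_gt0.
    have [c hc] := hx _ e2; have [c' hc'] := hy _ e2.
    exists (c ++ c'); rewrite /comb big_cat opprD addrACA [e]splitr.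
    by apply: le_lt_trans (ler_normD _ _) _; rewrite ltrD.
  - move=> i _ e e0; have [t _ <-] := vd i.
    have d1 : 0 < `|d t| + 1 by rewrite ltr_wpDl.
    have [m hm] := qd (a i) _ (divr_gt0 e0 d1).
    exists [:: (m, t)]; rewrite /comb big_seq1 /= -scalerBl normrZ.
    apply: (@le_lt_trans _ _ (`|a i - q m| * (`|d t| + 1))).
      by rewrite ler_wpM2l // lerDl.
    by rewrite -ltr_pdivlMr.
have h2 : 0 < 2^-1 :> K by rewrite invr_gt0.
have h4 : 0 < 2^-1 / 2 :> K by rewrite divr_gt0.
have /choice[c cP] : forall x, exists c, `|g x - comb c| < 2^-1.
  move=> x.
  have [y /combP/(_ _ h4)[c yc] xy] := (closure_normP _ _).1 (dZ (g x)) _ h4.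
  exists c; rewrite -[g x](subrK y) -addrA [2^-1]splitr.
  by apply: le_lt_trans (ler_normD _ _) _; rewrite ltrD.
have [x [y [xy cxy]]] := cantor_not_injective (pickle \o c).
exists x, y; split => //.
have {}cxy : c x = c y by apply: (pcan_inj pickleK).
rewrite -[g x](subrK (comb (c x))) -addrA [1]splitr.
apply: le_lt_trans (ler_normD _ _) _; rewrite mul1r ltrD //.
by rewrite distrC cxy.
Qed.

(** * Families of functionals *)

Section Families.
Variables (R : realType) (K : numFieldType) (hK : real_or_complex R K).

(** An infinite [B] would contain finite subsets with more than [M / e] elements. *)
Lemma bounded_size_finite (J : choiceType) (B : set J) (e M : K) :
  0 < e -> (forall s, uniq s -> (forall j, j \in s -> B j) -> e *+ size s <= M) ->
  finite_set B.
Proof.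
move=> e0 sM; apply: contrapT => Binf.
have M0 : 0 <= M by have := sM [::] isT; apply.
have [|n Mn] := @scalar_archimedean _ _ hK (M / e); first by rewrite divr_ge0 // ltW.
have [D DB nD] := infinite_set_fset n Binf.
have := sM (finmap.enum_fset D) (finmap.fset_uniq D) (fun j Dj => DB j Dj).
suff Me : M < e *+ size (finmap.enum_fset D) by rewrite (lt_geF Me).
rewrite -mulr_natl -ltr_pdivrMr //; apply: lt_le_trans Mn _.
by rewrite ler_nat.
Qed.

Lemma mulrn_size_le_sum (J : eqType) (s : seq J) (a : J -> K) (e : K) :
  (forall j, j \in s -> e <= a j) -> e *+ size s <= \sum_(j <- s) a j.
Proof.
elim: s => [|j s IHs] h; first by rewrite big_nil.
rewrite big_cons mulrS lerD ?h ?mem_head // IHs // => k ks.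
by rewrite h // inE ks orbT.
Qed.

(** Choose [P] whose sum is within [e] of the supremum of all finite sums; a disjoint [Q] can add no
    more than [e]. *)
Lemma summable_tail (J : eqType) (a : J -> K) (M e : K) :
  (forall j, 0 <= a j) -> (forall s, uniq s -> \sum_(j <- s) a j <= M) ->
  0 < e -> exists2 P, uniq P &
    forall Q, uniq Q -> (forall j, j \in Q -> j \notin P) -> \sum_(j <- Q) a j <= e.
Proof.
move=> a0 aM e0; pose A := [set x | exists2 s, uniq s & x = \sum_(j <- s) a j].
have [|||m [mA mle]] := @real_or_complex_supremums _ _ A hK.
- by exists 0, [::] => //; rewrite big_nil.
- by move=> _ [s _ ->]; exact: sumr_ge0.
- by exists M => _ [s us ->]; exact: aM.
have [[P uP mP]|nP] := pselect (exists2 P, uniq P & m - e < \sum_(j <- P) a j).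
  exists P => // Q uQ PQ; rewrite -(lerD2l (\sum_(j <- P) a j)) -big_cat /=.
  apply: (@le_trans _ _ m); last by rewrite -lerBlDr ltW.
  apply: mA; exists (P ++ Q) => //; rewrite cat_uniq uP uQ andbT /=.
  by apply/hasPn => j /PQ.
have m0 : 0 <= m by apply: mA; exists [::] => //; rewrite big_nil.
have mr : m - e \is Num.real by rewrite realB ?(gtr0_real e0) ?(ger0_real m0).
have : m <= m - e.
  apply: mle => _ [s us ->]; rewrite real_leNgt ?(ger0_real (sumr_ge0 _ _)) //.
  by apply/negP => ms; apply: nP; exists s.
by rewrite lerDl oppr_ge0 lt_geF.
Qed.

(** The hypothesis makes [w] behave like the unit vectors of c_0, on which functionals are summable:
    rotating the coefficients turns the values of [phi] into their moduli. *)
Lemma operator_sum_le (V : normedModType K) (phi : operator V K^o) (M : K)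
    (J : Type) (s : seq J) (w : J -> V) : 0 <= M ->
  (forall x, `|phi x| <= M * `|x|) ->
  (forall u : J -> K, (forall j, `|u j| <= 1) -> `|\sum_(j <- s) u j *: w j| <= 1) ->
  \sum_(j <- s) `|phi (w j)| <= M.
Proof.
(* Division by 0 gives 0, so [u j] is 0 when [phi] vanishes at [w j]. *)
move=> M0 phiM ws; pose u j := `|phi (w j)| / phi (w j).
have u1 j : `|u j| <= 1.
  rewrite /u normrM normfV normr_id.
  have [->|p0] := eqVneq (phi (w j)) 0; first by rewrite normr0 mul0r ler01.
  by rewrite divff ?normr_eq0.
have E : \sum_(j <- s) `|phi (w j)| = phi (\sum_(j <- s) u j *: w j).
  rewrite linear_sum; apply: eq_bigr => j _; rewrite linearZ /=.
  have [p0|p0] := eqVneq (phi (w j)) 0; first by rewrite p0 scaler0 normr0.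
  by rewrite /u [RHS]divfK.
rewrite -[leLHS]ger0_norm ?sumr_ge0 // E; apply: le_trans (phiM _) _.
by rewrite -[leRHS]mulr1 ler_wpM2l // ws.
Qed.

Section Indicators.
Variable I : Type.

Lemma indicator_bounded (P : I -> bool) :
  (fun i => (P i)%:R) \in @is_bounded K I.
Proof. by apply: mem_set; exists 1 => i; case: (P i); rewrite ?normr1 ?normr0. Qed.

(** An element of l^oo, regarded as the dual of [l1]. *)
Definition l1_indicator (P : I -> bool) : dual hK (l1 hK I) :=
  l1_dual (Linf (indicator_bounded P) : linf_of I hK).

Lemma l1_indicator_basis P i : l1_indicator P (l1_basis hK i) = (P i)%:R.
Proof. by []. Qed.

Lemma l1_indicator_norm P : `|l1_indicator P| <= 1.
Proof.
apply: l1_dual_norm => // i; rewrite l1_indicator_basis.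
by case: (P i); rewrite ?normr1 ?normr0.
Qed.

Lemma dual_addE (V : normedModType K) (phi psi : dual hK V) x :
  (phi + psi) x = phi x + psi x.
Proof. by []. Qed.

Lemma dual_scaleE (V : normedModType K) (a : K) (phi : dual hK V) x :
  (a *: phi) x = a * phi x.
Proof. by []. Qed.

Lemma dual_sumE (V : normedModType K) (J : Type) (s : seq J)
    (w : J -> dual hK V) x :
  (\sum_(j <- s) w j) x = \sum_(j <- s) w j x.
Proof.
by elim: s => [|j s IHs]; rewrite ?big_nil // !big_cons dual_addE IHs.
Qed.

(** At each basis vector at most one summand is nonzero. This supplies the hypothesis of
    [operator_sum_le]. *)
Lemma disjoint_indicators_norm (J : eqType) (s : seq J) (P : J -> I -> bool)
    (u : J -> K) : uniq s ->
  (forall i j j', j \in s -> j' \in s -> P j i -> P j' i -> j = j') ->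
  (forall j, `|u j| <= 1) ->
  `|\sum_(j <- s) u j *: l1_indicator (P j)| <= 1.
Proof.
move=> us Ps u1; apply: l1_dual_norm => // i; rewrite dual_sumE.
rewrite (eq_bigr (fun j => u j * (P j i)%:R)); last first.
  by move=> j _; rewrite dual_scaleE l1_indicator_basis.
have [/hasP[j sj Pj]|/hasPn nP] := boolP (has (P^~ i) s).
  rewrite (bigD1_seq j) //= Pj mulr1 big1_seq ?addr0 //.
  move=> k /andP[kj sk].
  have [Pk|] := boolP (P k i); last by rewrite mulr0.
  by rewrite (Ps i k j) ?eqxx in kj.
rewrite big1_seq ?normr0 // => j /= sj.
by rewrite (negbTE (nP _ sj)) mulr0.
Qed.

End Indicators.

(** The family itself, with 0 adjoined, is the weakly compact generating set, by
    [weakly_compact_null]. *)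
Lemma closed_span_WCG (F : completeNormedModType K) (J : Type) (z : J -> F) :
  (forall (phi : operator (elt_of (closed_span (range z))) K^o) (e : K), 0 < e ->
    finite_set [set j | e <= `|phi (EltOf (mem_closed_span (imageT z j)))| ]) ->
  WCG_space (elt_of (closed_span (range z))).
Proof.
move=> zfin; pose zz j := EltOf (mem_closed_span (imageT z j)).
exists (0 |` range zz); split; first exact: weakly_compact_null.
apply/dense_closureP => u.
have := (dense_closureP _).1 (@linear_span_closed_span_dense _ _ (range z)) u.
apply: closure_subset; apply: linear_span_min.
- exact: linear_span0.
- by move=> *; exact: linear_spanP.
- move=> v [j _ jv]; apply: mem_linear_span; right; exists j => //.
  exact: val_inj.
Qed.

End Families.

(** * Branches of the binary tree *)

Lemma dense_sub_closed_subspace (K : numFieldType) (V : normedModType K)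
    (S : set V) (Z : closed_subspace V) :
  dense (linear_span S) -> (forall v, S v -> v \in Z) -> forall v, v \in Z.
Proof.
move=> /dense_closureP dS SZ v.
have SpanZ : linear_span S `<=` [set` Z].
  apply: linear_span_min => //=; first exact: rpred0.
  by move=> a x y hx hy; rewrite rpredD // rpredZ.
suff : [set` Z] v by [].
rewrite ((closure_id _).1 (@Defs.closed_subspaceP _ _ Z)).
exact: closure_subset SpanZ _ (dS v).
Qed.

Section Branches.
Variables (R : realType) (K : numFieldType) (hK : real_or_complex R K).
Local Notation word := (seq bool).
Local Notation branch := (nat -> bool).
Implicit Types (x y : branch) (s t : word).

(** For fixed [x] these words form the set A_x; distinct branches share only finitely many of
    them. *)
Definition prefix_of x s := s == mkseq x (size s).

Lemma prefix_of_mkseq x n : prefix_of x (mkseq x n).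
Proof. by rewrite /prefix_of size_mkseq. Qed.

Lemma branch_neqP x y : x <> y -> exists n, x n <> y n.
Proof.
move=> xy; apply: contrapT => /forallNP h.
by apply: xy; apply/funext => n; apply: contrapT.
Qed.

Lemma mkseq_eq_ltn x y n m : (m < n)%N -> mkseq x n = mkseq y n -> x m = y m.
Proof. by move=> mn /(congr1 (nth true ^~ m)); rewrite !nth_mkseq. Qed.

(** Almost disjointness made uniform: a word of length at least [L] lies on at most one branch of
    [B]. [L] exceeds a place of disagreement for every pair. *)
Lemma branches_separated (B : seq branch) : exists L, forall x y,
  x \in B -> y \in B -> mkseq x L = mkseq y L -> x = y.
Proof.
have /choice[n nP] : forall p : branch * branch, exists n, p.1 <> p.2 -> p.1 n <> p.2 n.
  move=> [x y]; have [xy|/branch_neqP[n xyn]] := pselect (x = y).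
    by exists 0%N => /(_ xy).
  by exists n.
exists (\max_(x <- B) \max_(y <- B) (n (x, y)).+1) => x y xB yB xy.
apply: contrapT => /(nP (x, y)); apply; apply: mkseq_eq_ltn xy.
by apply: leq_trans (leq_bigmax_seq _ xB isT); apply: (leq_bigmax_seq _ yB).
Qed.

Local Notation E := (l1 hK word).
Local Notation F := (dual hK E).

Definition branch_indicator x : F := l1_indicator hK (prefix_of x).

Lemma word_eval_is_operator (Z : closed_subspace F) s :
  (fun u : elt_of Z => elt_val u (l1_basis hK s)) \in @is_operator K (elt_of Z) K^o.
Proof.
apply: mem_set; split.
  by move=> a u v; rewrite linearP; exact: operator_linE.
exists 1 => u; rewrite mul1r; apply: le_trans (dual_norm_le (elt_val u) _) _.
rewrite -[leRHS]mulr1 ler_wpM2l ?dual_norm_ge0 //; exact: l1_basis_norm.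
Qed.

(** Indicators of distinct branches are at distance at least 1, while the countably many word
    coordinates separate the points of [Z]; this contradicts [WCG_not_discrete]. *)
Lemma branches_not_WCG (Z : closed_subspace F) :
  (forall x, branch_indicator x \in Z) -> ~ WCG_space (elt_of Z).
Proof.
move=> gZ wZ.
pose f (n : nat) := Operator (word_eval_is_operator Z (odflt ([::] : word) (unpickle n))).
have [|x [y [xy]]] := @WCG_not_discrete _ _ hK _ f (fun x => EltOf (gZ x)) wZ.
  move=> v fv; apply: val_inj; apply: l1_dual_ext => s.
  have : elt_val v (l1_basis hK (odflt ([::] : word) (unpickle (pickle s)))) = 0.
    exact: fv.
  by rewrite pickleK.
apply/negP; have [n xyn] := branch_neqP xy.
rewrite -real_leNgt ?ger0_real //.
(* Length [n.+1] is the least that includes letter [n], where the branches differ. *)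
pose b := l1_basis hK (mkseq x n.+1).
apply: (@le_trans _ _ `|(branch_indicator x - branch_indicator y) b|).
  have -> : (branch_indicator x - branch_indicator y) b = 1; last by rewrite normr1.
  rewrite [LHS]/(l1_indicator hK (prefix_of x) b - l1_indicator hK (prefix_of y) b).
  rewrite !l1_indicator_basis prefix_of_mkseq.
  suff /negbTE -> : ~~ prefix_of y (mkseq x n.+1) by exact: subr0.
  apply/negP; rewrite /prefix_of size_mkseq => /eqP /mkseq_eq_ltn.
  by move=> /(_ n (ltnSn n)).
apply: le_trans (dual_norm_le _ _) _.
rewrite -[leRHS]mulr1 ler_wpM2l ?dual_norm_ge0 //; exact: l1_basis_norm.
Qed.

Lemma harmonic_finite (J : countType) (M e : K) : 0 < e ->
  finite_set [set j : J | e <= (pickle j).+1%:R^-1 * M].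
Proof.
move=> e0; have [|n Mn] := @scalar_archimedean _ _ hK (`|M| / e).
  by rewrite divr_ge0 // ltW.
apply: (@sub_finite_set _ _ (pickle @^-1` `I_n)).
  move=> j /=; rewrite ler_pdivlMl ?ltr0n // => ej.
  rewrite -(ltr_nat K); apply: lt_trans Mn; rewrite ltr_pdivlMr //.
  apply: (@lt_le_trans _ _ ((pickle j).+1%:R * e)).
    by rewrite ltr_pM2r // ltr_nat.
  have M0 : 0 <= M by apply: le_trans ej; rewrite mulr_ge0 // ltW.
  by rewrite ger0_norm.
apply: finite_preimage; last exact: finite_II.
by move=> j k _ _; exact: (pcan_inj pickleK).
Qed.

(** Scaling [b i] by [(pickle i).+1%:R^-1] makes the family null in norm, hence weakly null, without
    changing its span. *)
Lemma separable_WCG (V : completeNormedModType K) (I : countType) (b : I -> V) :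
  (forall i, `|b i| <= 1) -> dense (linear_span (range b)) ->
  exists Z : closed_subspace V, WCG_space (elt_of Z) /\ forall v, v \in Z.
Proof.
move=> b1 db; pose z (i : I) : V := (pickle i).+1%:R^-1 *: b i.
exists (closed_span (range z)); split.
  apply: closed_span_WCG => phi e e0; have [M M0 phiM] := operator_bound phi.
  apply: (sub_finite_set _ (@harmonic_finite I M e e0)) => i /= ei.
  apply: le_trans ei _; apply: le_trans (phiM _) _; rewrite mulrC ler_wpM2r //.
  have : `|z i| <= (pickle i).+1%:R^-1; last exact.
  rewrite normrZ ger0_norm ?invr_ge0 // -[leRHS]mulr1.
  by rewrite ler_wpM2l ?invr_ge0.
apply: dense_sub_closed_subspace db _ => _ [i _ <-].
have -> : b i = (pickle i).+1%:R *: z i.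
  by rewrite scalerA divff ?scale1r // pnatr_eq0.
by rewrite rpredZ //; apply: mem_closed_span; exists i.
Qed.

Lemma dual_eval_is_operator (V : normedModType K) (v : V) :
  (fun phi : dual hK V => phi v) \in @is_operator K (dual hK V) K^o.
Proof.
apply: mem_set; split; first by move=> a phi psi; exact: operator_linE.
by exists `|v| => phi; rewrite mulrC; exact: dual_norm_le.
Qed.

Definition dual_eval (V : normedModType K) (v : V) : dual hK (dual hK V) :=
  Operator (dual_eval_is_operator v).

Definition word_functional s : F := l1_indicator hK (pred1 s).

Definition branch_tail L x : F :=
  l1_indicator hK (fun s => prefix_of x s && (L <= size s)%N).

(** Each word on the branch is counted once: if its length is below [L], it is [mkseq x k] for
    exactly one [k], its length; otherwise it belongs to the tail. *)
Lemma branch_indicatorE L x : branch_indicator x =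
  \sum_(k <- iota 0 L) word_functional (mkseq x k) + branch_tail L x.
Proof.
apply: l1_dual_ext => s; rewrite dual_addE dual_sumE !l1_indicator_basis.
rewrite (eq_bigr (fun k => (s == mkseq x k)%:R)); last first.
  by move=> k _; rewrite l1_indicator_basis.
rewrite -natr_sum -natrD; congr (_%:R).
have -> : (\sum_(k <- iota 0 L) (s == mkseq x k) =
    count (fun k => s == mkseq x k) (iota 0 L))%N.
  by rewrite -sum1_count [RHS]big_mkcond; apply: eq_bigr => k _; case: eqP.
have [sx|sx] := boolP (prefix_of x s); last first.
  rewrite (eq_count (a2 := pred0)) ?count_pred0 // => k /=.
  by apply: contraNF sx => /eqP ->; exact: prefix_of_mkseq.
rewrite (eq_count (a2 := pred1 (size s))); last first.
  move=> k /=; apply/eqP/eqP => [->|->]; first by rewrite size_mkseq.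
  exact/eqP.
by rewrite count_uniq_mem ?iota_uniq // mem_iota add0n leq0n /=; case: ltnP.
Qed.

(** The tails are disjoint: a word of length at least [L] determines the first [L] letters of any
    branch through it. *)
Lemma branch_tail_sum (B : seq branch) (L : nat) (u : branch -> K) :
  uniq B -> (forall x y, x \in B -> y \in B -> mkseq x L = mkseq y L -> x = y) ->
  (forall x, `|u x| <= 1) -> `|\sum_(x <- B) u x *: branch_tail L x| <= 1.
Proof.
move=> uB BL u1; apply: disjoint_indicators_norm => // s x y xB yB.
move=> /andP[/eqP sx Ls] /andP[/eqP sy _]; apply: BL => //.
have h z : s = mkseq z (size s) -> mkseq z L = take L s.
  by move=> ->; rewrite /mkseq -map_take take_iota (minn_idPl _) // size_map size_iota.
by rewrite (h x sx) (h y sy).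
Qed.

End Branches.

(** * The adjoint of the branch operator *)

Section Adjoint.
Variables (R : realType) (K : numFieldType) (hK : real_or_complex R K).
Local Notation word := (seq bool).
Local Notation branch := (nat -> bool).
Implicit Types (x y : branch) (s t : word).
Local Notation E := (l1 hK word).
Local Notation F := (dual hK E).
Local Notation G := (l1 hK branch).

(** The two kinds generate the separable summand and c_0(2^N). The indicator of the branches through
    [s] is the value of the adjoint at [dual_eval hK (l1_basis hK s)]; the scaling makes these
    vectors null in norm. *)
Definition adjoint_generator (j : word + branch) : dual hK G :=
  match j with
  | inl s => (pickle s).+1%:R^-1 *: l1_indicator hK (fun x => prefix_of x s)
  | inr y => l1_indicator hK (pred1 y)
  end.

(** A functional is small on almost all words by the scaling, and on almost all branches because the
    unit vectors [l1_indicator hK (pred1 y)] are disjoint, so that its values on them are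
    summable. *)
Lemma adjoint_generator_WCG :
  WCG_space (elt_of (closed_span (range adjoint_generator))).
Proof.
apply: closed_span_WCG => phi e e0; have [M M0 phiM] := operator_bound phi.
set A := (X in finite_set X).
have fw : finite_set [set s : word | A (inl s)].
  apply: (sub_finite_set _ (@harmonic_finite _ _ hK word M e e0)) => s /= es.
  apply: le_trans es _; apply: le_trans (phiM _) _; rewrite mulrC ler_wpM2r //.
  have : `|adjoint_generator (inl s)| <= (pickle s).+1%:R^-1; last exact.
  rewrite /= normrZ ger0_norm ?invr_ge0 // -[leRHS]mulr1.
  by rewrite ler_wpM2l ?invr_ge0 ?l1_indicator_norm.
have fb : finite_set [set y : branch | A (inr y)].
  apply: (@bounded_size_finite _ _ hK _ _ e M e0) => B uB BA.
  pose z y := EltOf (mem_closed_span (imageT adjoint_generator (inr y))).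
  apply: (@le_trans _ _ (\sum_(y <- B) `|phi (z y)|)).
    by apply: mulrn_size_le_sum => y /BA.
  apply: operator_sum_le => // u u1.
  have : `|\sum_(y <- B) u y *: l1_indicator hK (pred1 y)| <= 1.
    apply: disjoint_indicators_norm => // x y y' _ _ /eqP -> /eqP //.
  have -> : \sum_(y <- B) u y *: l1_indicator hK (pred1 y) =
    elt_val (\sum_(y <- B) u y *: z y).
    by rewrite linear_sum; apply: eq_bigr => y _; rewrite linearZ.
  exact.
apply: (@sub_finite_set _ _
  ((inl @` [set s | A (inl s)]) `|` (inr @` [set y | A (inr y)]))).
  by move=> [s|y] Aj; [left; exists s|right; exists y].
by rewrite finite_setU; split; exact: finite_image.
Qed.

Section Approximation.
Variables (Phi : dual hK F) (e : K).
Hypothesis e0 : 0 < e.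

(* Up to [e], the values of a functional on words are carried by a finite set
   [P]; removing them leaves a functional that is small on all but finitely
   many branches, because branches become disjoint after finitely many words. *)
Lemma dual_branch_approximation : exists (P : seq word) (B : seq branch),
  uniq B /\ forall x, x \notin B ->
    `|Phi (branch_indicator hK x) -
      \sum_(s <- P) Phi (word_functional hK s) * (prefix_of x s)%:R| <= e + e.
Proof.
have [M M0 PhiM] := operator_bound Phi.
pose a s := `|Phi (word_functional hK s)|.
have aM Q : uniq Q -> \sum_(s <- Q) a s <= M.
  move=> uQ; apply: operator_sum_le => // u u1.
  apply: disjoint_indicators_norm => //.
  by move=> t s s' _ _ /= /eqP <- /eqP.
have [P uP Ptail] := summable_tail hK (fun s => normr_ge0 _) aM e0.
(* Subtracting the evaluations at the words of [P] with suitable weights makes [Psi] vanish on the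
   words of [P] and agree with [Phi] on all others. *)
have [Psi PsiE] : exists Psi : dual hK F, forall phi, Psi phi =
    Phi phi - \sum_(s <- P) Phi (word_functional hK s) * phi (l1_basis hK s).
  exists (Phi - \sum_(s <- P)
    Phi (word_functional hK s) *: dual_eval hK (l1_basis hK s)) => phi.
  by rewrite dual_addE -scaleN1r dual_scaleE dual_sumE mulN1r; congr (_ - _).
have [N N0 PsiN] := operator_bound Psi.
have Psi_word s : `|Psi (word_functional hK s)| <= if s \in P then 0 else a s.
  rewrite PsiE (eq_bigr (fun t => Phi (word_functional hK t) * (t == s)%:R)); last first.
    by move=> t _; rewrite l1_indicator_basis.
  have [sP|sP] := boolP (s \in P).
    rewrite (bigD1_seq s) //= eqxx mulr1 big1 ?addr0 ?subrr ?normr0 // => t ts.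
    by rewrite (negbTE ts) mulr0.
  rewrite big1_seq ?subr0 // => t /= tP.
  by rewrite (_ : t == s = false) ?mulr0 //; apply: contraNF sP => /eqP <-.
(* The part of the branch below level [L] costs at most [e], whatever [L] is, because only words
   outside [P] contribute. *)
have Psi_tail L x : `|Psi (branch_indicator hK x)| <= e + `|Psi (branch_tail hK L x)|.
  rewrite (branch_indicatorE hK L x) linearD /=.
  apply: le_trans (ler_normD _ _) _; rewrite lerD2r linear_sum.
  apply: le_trans (ler_norm_sum _ _ _) _.
  pose Q := [seq s <- [seq mkseq x k | k <- iota 0 L] | s \notin P].
  have uQ : uniq Q.
    rewrite filter_uniq // map_inj_uniq ?iota_uniq // => k l /(congr1 size).
    by rewrite !size_mkseq.
  apply: le_trans (Ptail Q uQ _); last by move=> s; rewrite mem_filter => /andP[].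
  rewrite big_filter big_map [leRHS]big_mkcond /=; apply: ler_sum => k _.
  by apply: le_trans (Psi_word _) _; case: (_ \in P).
(* Let [L] separate a finite set [B] of bad branches. [Psi] is at least [e] in modulus on each tail,
   and its moduli on the disjoint tails sum to at most [N], which bounds the size of [B]. *)
have fin : finite_set [set x | ~ `|Psi (branch_indicator hK x)| <= e + e].
  apply: (@bounded_size_finite _ _ hK _ _ e N e0) => B uB Bbig.
  have [L BL] := branches_separated B.
  apply: (@le_trans _ _ (\sum_(x <- B) `|Psi (branch_tail hK L x)|)).
    apply: mulrn_size_le_sum => x /Bbig /= nx.
    rewrite real_leNgt ?normr_real ?(gtr0_real e0) //; apply/negP => xe; apply: nx.
    by apply: le_trans (Psi_tail L x) _; rewrite lerD2l ltW.
  apply: (@operator_sum_le _ _ Psi N _ B (branch_tail hK L)) => // u u1.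
  exact: branch_tail_sum.
have /finite_seqP[B0 B0E] := fin.
exists P, (undup B0); split => [|x]; first exact: undup_uniq.
rewrite mem_undup => xB0.
have : `|Psi (branch_indicator hK x)| <= e + e.
  apply: contrapT => h.
  have : [set x | ~ `|Psi (branch_indicator hK x)| <= e + e] x by [].
  by rewrite B0E /= (negbTE xB0).
by rewrite PsiE.
Qed.

End Approximation.

Lemma adjoint_mem_closed_span (T : operator G F) (Phi : dual hK F) :
  (forall x, T (l1_basis hK x) = branch_indicator hK x) ->
  adjoint hK T Phi \in closed_span (range adjoint_generator).
Proof.
move=> TE; apply/closed_spanP/closure_normP => e e0.
(* The approximation error becomes [e / 4], which leaves room for the strict inequality. *)
have e4 : 0 < e / 2 / 2 / 2 by rewrite !divr_gt0.
have [P [B [uB approx]]] := dual_branch_approximation Phi e4.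
pose c x := Phi (branch_indicator hK x) -
      \sum_(s <- P) Phi (word_functional hK s) * (prefix_of x s)%:R.
(* The words of [P] approximate off [B]; on the finite set [B] the error [c x] is corrected exactly
   by unit vectors. The factor [1] fits the form of [linear_spanP]. *)
exists (1 *: (\sum_(s <- P)
    Phi (word_functional hK s) *: l1_indicator hK (fun x => prefix_of x s))
  + \sum_(x <- B) c x *: l1_indicator hK (pred1 x)).
  apply: linear_spanP; apply: linear_span_sum => j.
    have -> : l1_indicator hK (fun x => prefix_of x j) =
        (pickle j).+1%:R *: adjoint_generator (inl j) + 0.
      by rewrite addr0 scalerA divff ?scale1r // pnatr_eq0.
    apply: linear_spanP; last exact: linear_span0.
    by apply: mem_linear_span; exists (inl j).
  by apply: mem_linear_span; exists (inr j).
apply: (@le_lt_trans _ _ (e / 2)); last by rewrite ltr_pdivrMr // ltr_pMr // ltr1n.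
apply: l1_dual_norm => [|x]; first by rewrite ltW // divr_gt0.
rewrite scale1r dual_addE -scaleN1r dual_scaleE dual_addE !dual_sumE mulN1r.
rewrite [X in X - _](_ : _ = Phi (branch_indicator hK x)); last by rewrite -TE.
rewrite (eq_bigr (fun s => Phi (word_functional hK s) * (prefix_of x s)%:R)); last first.
  by move=> s _; rewrite dual_scaleE l1_indicator_basis.
rewrite [X in - (_ + X)](eq_bigr (fun y => c y * (x == y)%:R)); last first.
  by move=> y _; rewrite dual_scaleE l1_indicator_basis.
rewrite opprD addrA -/(c x).
have [xB|xB] := boolP (x \in B).
  rewrite (bigD1_seq x) //= eqxx mulr1 big1 ?addr0 ?subrr ?normr0.
    by rewrite ltW // divr_gt0.
  by move=> y yx; rewrite eq_sym (negbTE yx) mulr0.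
rewrite big1_seq ?subr0.
  apply: le_trans (approx x xB) _; rewrite -splitr.
  by rewrite ler_pdivrMr // ler_peMr ?ler1n // ltW // divr_gt0.
move=> y /= yB; rewrite (_ : x == y = false) ?mulr0 //.
by apply: contraNF xB => /eqP ->.
Qed.

End Adjoint.

(** * The two examples *)

Theorem proposition2p4 (R : realType) (K : numFieldType)
    (hK : real_or_complex R K) :
  ~ symmetric_class hK (@WCG K) /\
  (exists (E F : completeNormedModType K) (T : operator E F),
     WCG T /\ ~ WCG (adjoint hK T)) /\
  (exists (E F : completeNormedModType K) (T : operator E F),
     ~ WCG T /\ WCG (adjoint hK T)).
Proof.
pose E := l1 hK (seq bool).
have id_op : (idfun : E -> E) \in @is_operator K E E.
  by apply: mem_set; split => //; exists 1 => x; rewrite mul1r.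
pose T1 : operator E E := Operator id_op.
have WT1 : WCG T1.
  have [Z [WZ EZ]] := @separable_WCG _ _ hK E _ (@l1_basis _ _ hK (seq bool))
    (@l1_basis_norm _ _ hK _) (@l1_basis_dense _ _ hK _).
  by exists Z.
(* The adjoint fixes every functional, so a subspace containing its range contains all branch
   indicators. *)
have nWT1 : ~ WCG (adjoint hK T1).
  move=> [Z [WZ ZT]]; apply: branches_not_WCG WZ => x.
  have <- : adjoint hK T1 (branch_indicator hK x) = branch_indicator hK x.
    exact: val_inj.
  exact: ZT.
split; first by move=> /(_ _ _ T1 WT1).
split; first by exists E, E, T1.
(* The range of [T] contains all branch indicators, so [branches_not_WCG] applies to any [Z]
   containing that range. *)
have [T TE] := @l1_lift _ _ hK (nat -> bool) E (branch_indicator hK) 1 ler01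
  (fun x => l1_indicator_norm hK _).
exists (l1 hK (nat -> bool)), (dual hK E), T; split.
  by move=> [Z [WZ ZT]]; apply: branches_not_WCG WZ => x; rewrite -TE.
exists (closed_span (range (@adjoint_generator _ _ hK))); split.
  exact: adjoint_generator_WCG.
by move=> Phi; exact: adjoint_mem_closed_span.
Qed.
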